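(* Let $T\in(0,\infty)$. For all $\alpha_1,\alpha_2\in\mathbb{R}$, $\sigma_1>0$, $\sigma_2>0$ and $t\in(0,T)$, the following dichotomy holds: $$\mathsf{P}_{X^{(\alpha_1,\sigma_1)},t}\sim\mathsf{P}_{X^{(\alpha_2,\sigma_2)},t}\quad\text{if }\sigma_1=\sigma_2,$$ $$\mathsf{P}_{X^{(\alpha_1,\sigma_1)},t}\perp\mathsf{P}_{X^{(\alpha_2,\sigma_2)},t}\quad\text{if }\sigma_1\neq\sigma_2.$$
   Context: Let $(B_t)_{t\geq 0}$ be a one-dimensional standard Wiener process. For $\alpha\in\mathbb{R}$ and $\sigma>0$, $(X_t^{(\alpha,\sigma)})_{t\in[0,T)}$ denotes the unique strong solution (with continuous paths) of the SDE $$\mathrm{d}X_t^{(\alpha,\sigma)}=-\frac{\alpha}{T-t}X_t^{(\alpha,\sigma)}\,\mathrm{d}t+\sigma\,\mathrm{d}B_t,\quad t\in[0,T),\qquad X_0^{(\alpha,\sigma)}=0,$$ namely $X_t^{(\alpha,\sigma)}=\sigma\int_0^t\left(\frac{T-t}{T-s}\right)^\alpha\mathrm{d}B_s$, $t\in[0,T)$. For $t\in(0,T)$, $\mathsf{P}_{X^{(\alpha,\sigma)},t}$ denotes the law of $(X_s^{(\alpha,\sigma)})_{s\in[0,t]}$ on $(C[0,t],\mathcal{B}(C[0,t]))$, where $C[0,t]$ is the space of continuous real functions on $[0,t]$ (with the supremum norm) and $\mathcal{B}(C[0,t])$ is its Borel $\sigma$-algebra. For probability measures on the same measurable space, $\sim$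 denotes equivalence (mutual absolute continuity) and $\perp$ denotes singularity. *)

(* Defs.v *)
From HB Require Import structures.
From mathcomp Require Import all_boot all_order all_algebra.
From mathcomp Require Import all_classical all_reals all_analysis.

Set Implicit Arguments.
Unset Strict Implicit.
Unset Printing Implicit Defensive.

Import Order.TTheory GRing.Theory Num.Theory.
Import numFieldTopology.Exports numFieldNormedType.Exports.

Local Open Scope classical_set_scope.
Local Open Scope ring_scope.

(* C[0, t] with its supremum norm topology; see [nbhs_path_space]. *)
Definition path_space {R : realType} (t : R) : Type :=
  initial_topology
    (fun f : continuousType (set_type `[0, t]) R =>
       (f : set_type `[0, t] -> R) : {uniform (set_type `[0, t]) -> R}).

HB.instance Definition _ {R : realType} (t : R) :=
  Uniform.copy (path_space t)
    (initial_topology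
      (fun f : continuousType (set_type `[0, t]) R =>
         (f : set_type `[0, t] -> R) : {uniform (set_type `[0, t]) -> R})).

HB.instance Definition _ {R : realType} (t : R) :=
  isPointed.Build (path_space t)
    (mkcts (@cst_continuous (set_type `[0, t]) R 0)).

Lemma nbhs_path_space (R : realType) (t : R) (f : path_space t)
    (U : set (path_space t)) :
  nbhs f U <-> exists2 e : R, 0 < e &
    [set g : path_space t | forall s, `|f s - g s| < e] `<=` U.
Proof.
split.
  case=> V [[W oW WV] Vf VU].
  move: (Vf); rewrite -WV => Wf.
  have := open_nbhs_nbhs (conj oW Wf).
  move=> /uniform_nbhs[E [entE EW]].
  move: entE; rewrite -entourage_ballE => -[e e0 eE].
  exists e => // g gf; apply: VU; rewrite -WV; apply: EW => y _.
  by apply: eE; rewrite /ball/=; exact: gf.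
case=> e e0 eU.
suff : nbhs f [set g : path_space t | forall s, `|f s - g s| < e].
  exact: filterS.
have := @initial_continuous _ {uniform (set_type `[0, t]) -> R}
  (fun g : continuousType (set_type `[0, t]) R =>
     (g : set_type `[0, t] -> R) : {uniform (set_type `[0, t]) -> R}) f.
move=> /(_ [set g | forall s, `|f s - g s| < e]); apply.
apply/uniform_nbhs; exists [set xy | ball xy.1 e xy.2]; split.
  by rewrite -entourage_ballE; exists e.
by move=> g /= fg s; apply: fg.
Qed.

Definition borel_path_space {R : realType} (t : R) : Type :=
  g_sigma_algebraType (@open (path_space t)).

HB.instance Definition _ {R : realType} (t : R) :=
  Measurable.on (borel_path_space t).

Section measures.
Context d (E : measurableType d) (R : realType).
Implicit Types mu nu : set E -> \bar R.

Definition equivalent_measures mu nu := mu `<< nu /\ nu `<< mu.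

Definition mutually_singular mu nu :=
  exists2 A, measurable A & mu A = 0%E /\ nu (~` A) = 0%E.

End measures.

Section processes.
Context d (Omega : measurableType d) (R : realType) (P : probability Omega R).

(* Processes are indexed by all of R; every condition below only concerns the
   times of the intended index set, [0, +oo[ for B and [0, T[ for X. *)
Implicit Types B X : R -> {RV P >-> R}.

Record wiener_process B : Prop := {
  wiener_start : {ae P, forall w, B 0 w = 0} ;
  wiener_indep_increments : forall (n : nat) (t : nat -> R) (A : nat -> set R),
    0 <= t 0%N -> (forall i, (i < n)%N -> t i <= t i.+1) ->
    (forall i, measurable (A i)) ->
    P (\bigcap_(i < n) (B (t i.+1) \- B (t i)) @^-1` A i) =
    \big[mule/1%E]_(i < n) P ((B (t i.+1) \- B (t i)) @^-1` A i) ;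
  wiener_normal_increments : forall s t : R, 0 <= s -> s < t ->
    forall A : set R, measurable A ->
    P ((B t \- B s) @^-1` A) = normal_prob 0 (Num.sqrt (t - s)) A ;
  wiener_continuous :
    {ae P, forall w, {within `[0, +oo[, continuous (B ^~ w)}} }.

(* The natural filtration of B augmented by the P-null events. *)
Definition augmented_filtration B (t : R) : set (set Omega) :=
  <<s [set F | exists2 s, 0 <= s <= t & exists2 A : set R,
                 measurable A & F = B s @^-1` A]
      `|` [set F | measurable F /\ P F = 0%E] >>.

(* Strong solution with continuous paths, for the driving process B, of
     dX_t = - alpha / (T - t) X_t dt + sigma dB_t,  X_0 = 0,  t in [0, T[.
   The diffusion coefficient is constant, so the Ito integral of sigma over
   [0, t] is sigma (B_t - B_0). *)
Record strong_solution B (T alpha sigma : R) X : Prop := {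
  solution_continuous :
    forall w, {within `[0, T[, continuous (X ^~ w)} ;
  solution_adapted : forall t, 0 <= t < T ->
    forall A : set R, measurable A -> augmented_filtration B t (X t @^-1` A) ;
  solution_start : {ae P, forall w, X 0 w = 0} ;
  solution_sde : {ae P, forall w, forall t, 0 <= t < T ->
    X t w = X 0 w
      + (\int[lebesgue_measure]_(s in `[0, t]) (- (alpha / (T - s)) * X s w))
      + sigma * (B t w - B 0 w)} }.

End processes.

Lemma restriction_continuous (R : realType) (T t : R) (f : R -> R) :
  t < T -> {within `[0, T[, continuous f} ->
  continuous (fun s : set_type `[0, t] => f (set_val s)).
Proof.
move=> tT cf.
have : {within `[0, t], continuous f}.
  apply: continuous_subspaceW cf => x /=; rewrite !in_itv/= => /andP[-> /=].
  by move=> /le_lt_trans; apply.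
by move=> /subspace_sigL_continuousP.
Qed.

Section law.
Context d (Omega : measurableType d) (R : realType) (P : probability Omega R).
Variables (T t : R) (X : R -> {RV P >-> R}).
Hypothesis tT : t < T.
Hypothesis cX : forall w, {within `[0, T[, continuous (X ^~ w)}.

Definition path_map (w : Omega) : borel_path_space t :=
  mkcts (restriction_continuous tT (@cX w)).

Definition path_law : set (borel_path_space t) -> \bar R :=
  pushforward P path_map.

End law.

(* Main.v *)
From Pilot Require Import Defs.
From HB Require Import structures.
From mathcomp Require Import all_boot all_order all_algebra.
From mathcomp Require Import all_classical all_reals all_analysis.
From mathcomp Require Import measurable_realfun ring lra.
Import Order.TTheory GRing.Theory Num.Theory.
Import numFieldTopology.Exports numFieldNormedType.Exports.
Local Open Scope classical_set_scope.
Local Open Scope ring_scope.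

Set Implicit Arguments.
Unset Strict Implicit.
Unset Printing Implicit Defensive.

(** Different diffusion coefficients.  Along the grid with n + 1 steps of length
    t / (n + 1) the drift contributes O(1 / n) to each increment of X, so the
    quadratic variation of X and that of sigma B have the same limit, and the
    latter is almost surely sigma^2 t ([quadratic_variation_cvg],
    [wiener_quadratic_variation_ae]).  The quadratic variation is a measurable
    functional of the path, and the event that it stays close to sigma2^2 t
    separates the two laws.

    Equal diffusion coefficients.  By symmetry one absolute continuity is enough,
    and it is obtained from a discrete form of Girsanov's theorem.  The Euler schemes
    Y1 and Y2 of the two equations, built from the same Gaussian increments, are
    Markov chains whose transition kernels differ by a translation; hence
    E[Z_n f(Y1)] = E[f(Y2)] with an explicit product Z_n of Gaussian likelihood
    ratios ([change_of_drift]).  Two facts let n go to infinity.  The schemes converge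
    to the solutions path by path, by a discrete Gronwall argument ([euler_cvg]).
    The logarithm of Z_n is bounded below, uniformly for large n, along
    almost every path ([drift_density_lower_bound]): its stochastic part, a sum of
    c y dy, is rewritten as (c y^2 - sum of dc y^2 - sum of c dy^2) / 2, so that
    only the supremum and the quadratic variation of the path enter.  So for every
    e there are j and an event of probability at most e outside which Z_n is at
    least 1 / (j + 1) for all n >= j, and in the limit

        E[f(X1)] <= e + (j + 1) E[f(X2)]

    for every test functional f with values in [0, 1] that depends continuously on
    finitely many coordinates ([test_domination]).  Such functionals approximate in
    L1 the indicators of all sets of the sigma-algebra generated by the
    coordinates, for the sum of the two laws, so the inequality yields that a null
    set of the law of X2 is a null set of the law of X1
    ([null_of_test_domination]).  That sigma-algebra contains the Borel sets of
    C[0, t] ([open_path_cylinders]).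

    Only lower bounds on Z_n enter, and the converse domination comes from exchanging
    the two processes. *)

(** * Test functions and absolute continuity *)

Section L1_density.
Context d (E : measurableType d) (R : realType).
Variable F : set (E -> R).
Hypothesis F_measurable : forall f, F f -> measurable_fun setT f.
Hypothesis F_itv01 : forall f, F f -> forall x, 0 <= f x <= 1.
Hypothesis F_one : F (cst 1).
Hypothesis F_compl : forall f, F f -> F (fun x => 1 - f x).
Hypothesis F_mul : forall f g, F f -> F g -> F (fun x => f x * g x).
Variable mu : {finite_measure set E -> \bar R}.

(** Functions rather than sets are approximated, so that complements, products
    and pointwise limits cover both the generators and the set operations. *)
Definition L1_approximable (h : E -> R) := [/\ measurable_fun setT h,
  (forall x, 0 <= h x <= 1) & forall e : R, 0 < e ->
    exists2 f, F f & (\int[mu]_x `|h x - f x|%:E <= e%:E)%E].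

Let m_dist (h f : E -> R) : measurable_fun setT h -> measurable_fun setT f ->
  measurable_fun setT (fun x => `|h x - f x|%:E).
Proof.
move=> mh mf; apply/measurable_EFinP; apply: measurableT_comp => //.
exact: measurable_funB.
Qed.

Lemma L1_approximable_self f : F f -> L1_approximable f.
Proof.
move=> Ff; split; [exact: F_measurable|exact: F_itv01|move=> e e0; exists f => //].
under eq_integral do rewrite subrr normr0.
by rewrite integral0 lee_fin ltW.
Qed.

Lemma L1_approximable_compl h :
  L1_approximable h -> L1_approximable (fun x => 1 - h x).
Proof.
move=> [mh h01 hF]; split; first exact: measurable_funB.
  by move=> x; have := h01 x; lra.
move=> e /hF[f Ff hf]; exists (fun x => 1 - f x); first exact: F_compl.
rewrite (eq_integral (fun x => `|h x - f x|%:E)) // => x _.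
by rewrite distrC; congr (`|_|%:E); ring.
Qed.

(** For values in [0, 1], |h k - f g| <= |h - f| + |k - g|. *)
Lemma L1_approximable_mul h k : L1_approximable h -> L1_approximable k ->
  L1_approximable (fun x => h x * k x).
Proof.
move=> [mh h01 hF] [mk k01 kF]; split; first exact: measurable_funM.
  move=> x; have /andP[h0 h1] := h01 x; have /andP[k0 k1] := k01 x.
  by rewrite mulr_ge0//= mulr_ile1.
move=> e e0; have e20 : 0 < e / 2 by rewrite divr_gt0.
have [f Ff hf] := hF _ e20; have [g Fg kg] := kF _ e20.
exists (fun x => f x * g x); first exact: F_mul.
have [mf mg] := (F_measurable Ff, F_measurable Fg).
rewrite [leRHS](_ : _ = (e / 2)%:E + (e / 2)%:E)%E; last first.
  by rewrite -EFinD -splitr.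
apply: le_trans (leeD hf kg); rewrite -ge0_integralD//; last 2 first.
- exact: m_dist.
- exact: m_dist.
apply: ge0_le_integral => //.
- by apply: m_dist; apply: measurable_funM.
- by apply: emeasurable_funD; apply: m_dist.
move=> x _; rewrite -EFinD lee_fin.
have /andP[h0 h1] := h01 x; have /andP[k0 k1] := k01 x.
have /andP[f0 f1] := F_itv01 Ff x; have /andP[g0 g1] := F_itv01 Fg x.
rewrite (_ : _ - _ = (h x - f x) * k x + f x * (k x - g x)); last by ring.
rewrite (le_trans (ler_normD _ _))// !normrM (ger0_norm k0) (ger0_norm f0).
by rewrite lerD// ?ler_piMr// ler_piMl.
Qed.

(** A diagonal argument: dominated convergence makes some term of the sequence
    close to the limit, and that term is close to a test function. *)
Lemma L1_approximable_lim (h_ : nat -> E -> R) (h : E -> R) :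
  (forall n, L1_approximable (h_ n)) -> (forall x, 0 <= h x <= 1) ->
  (forall x, h_ ^~ x @ \oo --> h x) -> L1_approximable h.
Proof.
move=> hF h01 hh.
have mh : measurable_fun setT h.
  apply: (@measurable_fun_cvg _ _ _ _ h_) => [n|x _]; last exact: hh.
  by have [] := hF n.
split => // e e0.
have := @dominated_convergence _ _ _ mu _ measurableT (fun n => EFin \o h_ n)
  (EFin \o h) (cst 1%E).
case.
- by move=> n; apply/measurable_EFinP; have [] := hF n.
- exact/measurable_EFinP.
- by apply: aeW => x _; apply: cvg_EFin; [exact: nearW|exact: hh].
- exact: finite_measure_integrable_cst.
- apply: aeW => x n _ /=; have [_ /(_ x)/andP[h0 h1] _] := hF n.
  by rewrite lee_fin ger0_norm.
move=> _ /fine_cvgP[_ /cvgrPdist_lt/(_ (e / 2))] + _.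
rewrite divr_gt0// => /(_ isT)[n _ /(_ n (leqnn n))].
rewrite sub0r normrN /= => hn.
have [mn n01 /(_ (e / 2))] := hF n; rewrite divr_gt0// => /(_ isT)[f Ff hf].
exists f => //; have mf := F_measurable Ff.
rewrite [leRHS](_ : _ = (e / 2)%:E + (e / 2)%:E)%E; last first.
  by rewrite -EFinD -splitr.
have hne : (\int[mu]_x `|h_ n x - h x|%:E <= (e / 2)%:E)%E.
  have i0 : (0 <= \int[mu]_x `|h_ n x - h x|%:E)%E by apply: integral_ge0.
  have ifin : (\int[mu]_x `|h_ n x - h x|%:E < +oo)%E.
    apply: (@le_lt_trans _ _ (\int[mu]_x (cst 1 x))%E).
      apply: ge0_le_integral => //; first exact: m_dist.
      by move=> x _; rewrite lee_fin/= ler_norml; move: (h01 x) (n01 x); lra.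
    rewrite integral_cst//= mul1e -ge0_fin_numE//.
    exact: fin_num_measure.
  rewrite -[leLHS]fineK ?ge0_fin_numE// lee_fin.
  by move: (ltW hn); rewrite ger0_norm ?fine_ge0.
apply: le_trans (leeD hne hf); rewrite -ge0_integralD//; last 2 first.
- exact: m_dist.
- exact: m_dist.
apply: ge0_le_integral => //.
- exact: m_dist.
- by apply: emeasurable_funD; apply: m_dist.
move=> x _; rewrite -EFinD lee_fin (distrC (h_ n x)).
by rewrite (le_trans _ (ler_normD _ _))// addrA subrK.
Qed.

(** The complement of a countable union is the limit of the finite intersections
    of the complements, which are handled by products. *)
Lemma L1_approximable_sigma_algebra :
  sigma_algebra setT [set A | L1_approximable \1_A].
Proof.
have compl A : L1_approximable \1_A -> L1_approximable \1_(~` A).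
  rewrite (_ : \1_(~` A) = (fun x => 1 - \1_A x : R)).
    exact: L1_approximable_compl.
  by apply/funext => x; rewrite !indicE in_setC; case: (_ \in _);
    rewrite /= ?subrr ?subr0.
have inter A B : L1_approximable \1_A -> L1_approximable \1_B ->
    L1_approximable \1_(A `&` B).
  by move=> hA hB; rewrite indicI; exact: L1_approximable_mul.
have full : L1_approximable \1_(setT : set E).
  by rewrite indicT; exact: L1_approximable_self.
split => /=.
- by rewrite -setCT; exact: compl.
- by move=> A /compl; rewrite setTD.
move=> A hA.
pose B n := \bigcap_(k < n) ~` A k.
have hB n : L1_approximable \1_(B n).
  elim: n => [|n IH]; first by rewrite /B II0 bigcap_set0.
  by rewrite /B IIS bigcap_setU bigcap_set1; apply: inter => //; exact: compl.
rewrite -[\bigcup_k A k]setCK; apply: compl; rewrite setC_bigcup.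
apply: (@L1_approximable_lim (fun n => \1_(B n))) => //.
  by move=> x; rewrite indicE; case: (_ \in _); rewrite /= ?lexx ler01.
move=> x; have [xA|/existsNP[k /not_implyP[_ nAk]]] :=
    pselect ((\bigcap_k ~` A k) x).
  rewrite indicE mem_set//; apply: cvg_near_cst; apply: nearW => n /=.
  by rewrite indicE mem_set// => k _; exact: xA.
rewrite indicE memNset; last by move=> /(_ k I).
apply: cvg_near_cst; near=> n; rewrite indicE memNset//.
move=> /(_ k) nB; apply/nAk/nB => /=.
by near: n; exact: nbhs_infty_gt.
Unshelve. all: by end_near. Qed.

Lemma L1_approximable_generated (G : set (set E)) :
  (forall A, G A -> exists2 f_ : nat -> E -> R,
    (forall n, F (f_ n)) & forall x, f_ ^~ x @ \oo --> (\1_A x : R)) ->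
  forall A, <<s G >> A -> L1_approximable \1_A.
Proof.
move=> GF; apply: smallest_sub; first exact: L1_approximable_sigma_algebra.
move=> A /GF[f_ Ff fA] /=; apply: (@L1_approximable_lim f_) => //.
- by move=> n; exact: L1_approximable_self.
- by move=> x; rewrite indicE; case: (_ \in _); rewrite /= ?lexx ler01.
Qed.

End L1_density.

Section domination_by_tests.
Context d (E : measurableType d) (R : realType).
Variable F : set (E -> R).
Hypothesis F_measurable : forall f, F f -> measurable_fun setT f.
Hypothesis F_itv01 : forall f, F f -> forall x, 0 <= f x <= 1.
Hypothesis F_one : F (cst 1).
Hypothesis F_compl : forall f, F f -> F (fun x => 1 - f x).
Hypothesis F_mul : forall f g, F f -> F g -> F (fun x => f x * g x).
Variables mu nu : {finite_measure set E -> \bar R}.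
Variable G : set (set E).
Hypothesis G_lim : forall A, G A -> exists2 f_ : nat -> E -> R,
    (forall n, F (f_ n)) & forall x, f_ ^~ x @ \oo --> (\1_A x : R).
Hypothesis munu : forall e : R, 0 < e -> exists2 K : R, 0 <= K & forall f, F f ->
  (\int[mu]_x (f x)%:E <= e%:E + K%:E * \int[nu]_x (f x)%:E)%E.

(** Choose a test function close to the indicator of A for mu + nu.  Its integral
    against nu is then small because nu A = 0, hence so is its integral against mu,
    and therefore mu A. *)
Lemma null_of_test_domination A : <<s G >> A -> nu A = 0%E -> mu A = 0%E.
Proof.
move=> sA nuA.
pose m : {measure set E -> \bar R} := measure_add mu nu.
have mfin : fin_num_fun m.
  by move=> B mB; rewrite [m B]measure_addE fin_numD !fin_num_measure.
pose M : {finite_measure set E -> \bar R} :=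
  HB.pack_for (FiniteMeasure.type E R) (Measure.sort m)
    (Measure_isFinite.Build _ _ _ m mfin).
have [mA1 A01 AF] : L1_approximable F M \1_A.
  exact: L1_approximable_generated sA.
have mA : measurable A.
  have := mA1 measurableT [set 1] (measurable_set1 _); rewrite setTI.
  rewrite (_ : _ @^-1` _ = A)//; apply/seteqP; split => x /=.
    by rewrite indicE => /eqP; rewrite pnatr_eq1 eqb1 inE.
  by move=> Ax; rewrite indicE mem_set.
suff le3 (e : R) : 0 < e -> (mu A <= (3 * e)%:E)%E.
  apply/eqP; rewrite eq_le measure_ge0 andbT; apply/lee_addgt0Pr => e e0.
  rewrite add0e; have /le3 : 0 < e / 3 by rewrite divr_gt0.
  by rewrite mulrC divfK.
move=> e0; have [K K0 FK] := munu e0.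
(* With this accuracy the three errors below add up to at most 3 e. *)
have dlt : 0 < e / (1 + K) by rewrite divr_gt0// ltr_pwDl.
have [f Ff fA] := AF _ dlt.
have mf := F_measurable Ff.
have md : measurable_fun setT (fun x => `|\1_A x - f x|%:E).
  apply/measurable_EFinP; apply: measurableT_comp => //.
  exact: measurable_funB.
move: fA; rewrite /M/= ge0_integral_measure_add//= => fA.
have muf : (\int[mu]_x `|\1_A x - f x|%:E <= (e / (1 + K))%:E)%E.
  by apply: le_trans fA; rewrite leeDl// integral_ge0.
have nuf : (\int[nu]_x `|\1_A x - f x|%:E <= (e / (1 + K))%:E)%E.
  by apply: le_trans fA; rewrite leeDr// integral_ge0.
have f0 x : 0 <= f x by have /andP[] := F_itv01 Ff x.
have muA : (mu A <= \int[mu]_x (f x)%:E + (e / (1 + K))%:E)%E.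
  apply: le_trans (leeD2l _ muf).
  rewrite -[A in mu A]setIT -integral_indic// -ge0_integralD//; last 2 first.
  - by move=> x _; rewrite lee_fin.
  - exact/measurable_EFinP.
  apply: ge0_le_integral => //.
  - exact/measurable_EFinP.
  - by apply: emeasurable_funD => //; exact/measurable_EFinP.
  by move=> x _; rewrite -EFinD lee_fin -lerBlDl ler_norm.
have nuAf : (\int[nu]_x (f x)%:E <= (e / (1 + K))%:E)%E.
  apply: le_trans nuf; rewrite -[leRHS]add0e -nuA.
  rewrite -[A in nu A]setIT -integral_indic// -ge0_integralD//; last first.
  - exact/measurable_EFinP.
  apply: ge0_le_integral => //.
  - by move=> x _; rewrite lee_fin.
  - exact/measurable_EFinP.
  - by apply: emeasurable_funD => //; exact/measurable_EFinP.
  by move=> x _; rewrite -EFinD lee_fin -lerBlDl distrC ler_norm.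
have K1 : 0 < 1 + K by rewrite ltr_pwDl.
apply: (le_trans muA).
apply: (@le_trans _ _ ((e%:E + K%:E * (e / (1 + K))%:E) + (e / (1 + K))%:E)%E).
  rewrite leeD2r//; apply: le_trans (FK _ Ff) _.
  by rewrite leeD2l// lee_wpmul2l// lee_fin.
rewrite -EFinM -!EFinD lee_fin.
rewrite -addrA -{2}[e / _]mul1r -mulrDl (addrC K) mulrC divfK ?gt_eqF//.
by lra.
Qed.

End domination_by_tests.

(** * The Borel sets of the path space *)

(** Heine's theorem: the modulus of continuity plays the role of the filtered
    parameter in the covering characterization of compactness. *)
Lemma uniform_continuity_itv (R : realType) (t : R) (f : R -> R) :
  {within `[0, t], continuous f} -> forall e : R, 0 < e ->
  exists2 de : R, 0 < de & forall r s, 0 <= r <= t -> 0 <= s <= t ->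
    `|r - s| < de -> `|f r - f s| < e.
Proof.
move=> /subspace_continuousP cf e e0.
have /compact_near_coveringP cov : compact `[(0 : R), t] by exact: segment_compact.
have e20 : 0 < e / 2 by rewrite divr_gt0.
have := cov _ (0 : R)^'+ (fun de r => 0 <= r <= t ->
  forall s, 0 <= s <= t -> `|r - s| < de -> `|f r - f s| < e) _.
case.
  move=> x /= xt; have := cf x xt; move=> /cvgrPdist_lt/(_ _ e20).
  rewrite near_withinE => /nbhs_ballP[d /= d0 dP].
  have d20 : 0 < d / 2 by rewrite divr_gt0.
  near=> x' de => x't s st sx'.
  have xx' : `|x - x'| < d / 2.
    by near: x'; exact: (nbhsx_ballx x (d / 2)).
  have ded : de < d / 2 by near: de; exact: nbhs_right_lt.
  have fx' : `|f x - f x'| < e / 2.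
    apply: dP => /=; last by rewrite in_itv.
    by apply: (lt_trans xx'); rewrite gtr_pMr// invf_lt1// ltr1n.
  have fs : `|f x - f s| < e / 2.
    apply: dP => /=; last by rewrite in_itv.
    suff : `|x - s| < d by [].
    rewrite [ltRHS](splitr d); apply: (le_lt_trans (ler_distD x' _ _)).
    by rewrite ltrD// (lt_trans sx').
  rewrite (splitr e) (le_lt_trans (ler_distD (f x) _ _))//.
  by rewrite ltrD// distrC.
move=> d /= d0 dP; exists (d / 2); first by rewrite divr_gt0.
move=> r s rt st rs; apply: (dP (d / 2)) => //=.
- rewrite sub0r normrN gtr0_norm ?divr_gt0//.
  by rewrite gtr_pMr// invf_lt1// ltr1n.
- by rewrite divr_gt0.
Unshelve. all: by end_near. Qed.

Section path_sigma_algebra.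
Context {R : realType} (t : R).
Hypothesis t_gt0 : 0 < t.
Let t0 : 0 <= t := ltW t_gt0.

Let clamp_proof (r : R) : Num.max 0 (Num.min t r) \in `[0, t]%classic.
Proof.
rewrite inE /= in_itv/= le_max lexx/= ge_max t0/=.
by rewrite ge_min lexx.
Qed.

(** Precomposing a path with this retraction extends it to all real times, so that
    rational times are always admissible. *)
Definition clamp (r : R) : set_type `[0, t] := SigSub (clamp_proof r).

Lemma clampE r : 0 <= r <= t -> set_val (clamp r) = r.
Proof. by case/andP=> r0 rt; rewrite set_valE/= min_r// max_r. Qed.

Lemma clampK (s : set_type `[0, t]) : clamp (set_val s) = s.
Proof.
apply: val_inj => /=; case: s => s /= st.
by have := st; rewrite inE/= in_itv/= => /andP[? ?]; rewrite min_r// max_r.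
Qed.

Lemma clamp_lipschitz r s : `|set_val (clamp r) - set_val (clamp s)| <= `|r - s|.
Proof.
rewrite set_valE/=.
have max_lip (a b c : R) : `|Num.max a b - Num.max a c| <= `|b - c|.
  by case: (leP a b); case: (leP a c); rewrite ler_norml;
    case: (ger0P (b - c)) => *; apply/andP; split; lra.
have min_lip (a b c : R) : `|Num.min a b - Num.min a c| <= `|b - c|.
  by case: (leP a b); case: (leP a c); rewrite ler_norml;
    case: (ger0P (b - c)) => *; apply/andP; split; lra.
exact: le_trans (max_lip _ _ _) (min_lip _ _ _).
Qed.

Lemma continuous_clamp : continuous clamp.
Proof.
apply: continuous_comp_initial => r; apply/cvgrPdist_lt => /= e e0; near=> s.
apply: le_lt_trans (clamp_lipschitz _ _) _.
by near: s; exact: (nbhsx_ballx r e).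
Unshelve. all: by end_near. Qed.

Lemma continuous_path_clamp (x : path_space t) :
  continuous (fun r => x (clamp r)).
Proof.
move=> r; apply: (@continuous_comp _ _ _ clamp x); first exact: continuous_clamp.
exact: cts_fun.
Qed.

Lemma path_eval_open (s : set_type `[0, t]) (U : set R) :
  open U -> open [set x : path_space t | U (x s)].
Proof.
move=> oU; rewrite openE => x Ux; apply/nbhs_path_space.
have /nbhs_ballP[e /= e0 eU] : nbhs (x s) U by exact: open_nbhs_nbhs.
by exists e => // g gx; apply: eU; exact: gx.
Qed.

Lemma measurable_path_eval (s : set_type `[0, t]) :
  measurable_fun setT (fun x : borel_path_space t => x s).
Proof.
apply: (measurability _ (RGenOpens.measurableE R)).
move=> _ [_ [a [b ->]] <-]; rewrite setTI; apply: sub_sigma_algebra.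
exact: path_eval_open.
Qed.

Definition path_cylinders : set (set (path_space t)) :=
  [set A | exists s a b, A = [set x : path_space t | a <= x s <= b]].

(** An open set is the union of the sets C(n, q, m) that it contains, where
    C(n, q, m) consists of the paths that stay within 1 / (m + 1) of the rational q_i
    at all rational times less than one step away from the i-th point of the grid
    with n + 1 steps, for all i below the length of q.  There are countably many such
    sets, and each is a countable intersection of cylinders.  When q is as long as the
    grid, two paths in the same set differ by at most 2 / (m + 1), and uniform
    continuity puts any given path in such a set with m as large as desired. *)
Lemma open_path_cylinders (U : set (path_space t)) :
  open U -> <<s path_cylinders >> U.
Proof.
move=> oU.
pose S := g_sigma_algebraType path_cylinders.
pose h n : R := t / n.+1%:R.
pose C (c : nat * seq rat * nat) : set S := [set x : path_space t |
  forall (i : nat) (r : rat), (i < size c.1.2)%N ->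
    `|ratr r - i%:R * h c.1.1| < h c.1.1 ->
    `|x (clamp (ratr r)) - ratr (nth 0 c.1.2 i)| <= c.2.+1%:R^-1].
have mC c : measurable (C c).
  rewrite (_ : C c = \bigcap_i ~` \bigcup_(r : rat) ~` [set x : path_space t |
    (i < size c.1.2)%N -> `|ratr r - i%:R * h c.1.1| < h c.1.1 ->
    `|x (clamp (ratr r)) - ratr (nth 0 c.1.2 i)| <= c.2.+1%:R^-1]); last first.
    apply/seteqP; split => x /=.
      by move=> Cx i _ [r _]; apply; exact: Cx.
    by move=> Cx i r; apply: contrapT => nx; apply: (Cx i I); exists r.
  apply: bigcapT_measurable => i; apply: measurableC.
  apply: bigcupT_measurable_rat => r; apply: measurableC.
  have [/andP[ic ri]|/negP ri] := boolP ((i < size c.1.2)%N &&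
      (`|ratr r - i%:R * h c.1.1| < h c.1.1)); last first.
    rewrite (_ : [set _ | _] = setT)//; apply/seteqP; split => // x _ /= ic ri'.
    by case: ri; rewrite ic.
  apply: sub_sigma_algebra; exists (clamp (ratr r)).
  exists (ratr (nth 0 c.1.2 i) - c.2.+1%:R^-1).
  exists (ratr (nth 0 c.1.2 i) + c.2.+1%:R^-1).
  apply/seteqP; split => x /=; first by move=> /(_ ic ri); rewrite ler_distl.
  by move=> xab _ _; rewrite ler_distl.
suff -> : U = \bigcup_c (if pselect (C c `<=` U) then C c else set0).
  apply: (@countable_bigcupT_measurable _ S) => // c.
  by case: pselect => cU; [exact: mC|exact: measurable0].
apply/seteqP; split => [x Ux|x [c _]]; last by case: pselect => // CU /CU.
have /nbhs_path_space[e e0 eU] : nbhs x U by exact: open_nbhs_nbhs.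
have [m me] : exists m : nat, m.+1%:R^-1 < e / 2.
  have e2 : 0 < e / 2 by rewrite divr_gt0.
  exists (Num.truncn (e / 2)^-1); rewrite -[ltRHS]invrK ltf_pV2 ?posrE ?invr_gt0//.
  exact: truncnS_gt.
have [] := @uniform_continuity_itv R t (fun r => x (clamp r)) _
    (m.+1%:R^-1 / 2) _.
- by apply: continuous_subspaceT; exact: continuous_path_clamp.
- by rewrite divr_gt0.
move=> de de0 xde.
have [n nde] : exists n, h n < de.
  exists (Num.truncn (t / de)); rewrite /h ltr_pdivrMr// mulrC -ltr_pdivrMr//.
  exact: truncnS_gt.
have osc r s : `|r - s| < h n -> `|x (clamp r) - x (clamp s)| < m.+1%:R^-1 / 2.
  move=> rs; rewrite -[clamp r]clampK -[clamp s]clampK.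
  apply: xde; [| |exact: le_lt_trans (clamp_lipschitz _ _) (lt_trans rs nde)].
  - by have := set_valP (clamp r); rewrite /= in_itv.
  - by have := set_valP (clamp s); rewrite /= in_itv.
have /choice[q qP] : forall i : nat, exists q : rat,
    `|x (clamp (i%:R * h n)) - ratr q| < m.+1%:R^-1 / 2.
  move=> i; have [|q] := @rat_in_itvoo R (x (clamp (i%:R * h n)))
      (x (clamp (i%:R * h n)) + m.+1%:R^-1 / 2).
    by rewrite ltrDl divr_gt0.
  rewrite in_itv/= => /andP[q1 q2]; exists q.
  rewrite distrC ltr_norml ltrBlDl q2 andbT.
  by rewrite (@lt_trans _ _ 0) ?subr_gt0// oppr_lt0 divr_gt0.
(* Indices run up to n.+1, since the last cell may start at t itself. *)
exists (n, mkseq q n.+2, m) => //.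
case: pselect => [CU|].
  move=> i r; rewrite size_mkseq => i_n ri; rewrite nth_mkseq//.
  rewrite [leRHS]splitr (le_trans (ler_distD (x (clamp (i%:R * h n))) _ _))//.
  by apply: lerD; apply: ltW; [exact: osc|exact: qP].
case=> y Cy; apply: eU => s /=.
have /andP[s0 st] : 0 <= set_val s <= t.
  by have := set_valP s; rewrite /= in_itv.
have h0 : 0 < h n by rewrite divr_gt0.
pose i := Num.truncn (set_val s / h n).
have in2 : (i < n.+2)%N.
  rewrite truncn_lt_nat; last by rewrite divr_ge0// ltW.
  rewrite ltr_pdivrMr// /h (le_lt_trans st)// mulrCA ltr_pMr//.
  by rewrite ltr_pdivlMr// mul1r ltr_nat.
have si : `|set_val s - i%:R * h n| < h n.
  have /andP[i1 i2] : i%:R <= set_val s / h n < i.+1%:R.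
    by rewrite truncn_itv// divr_ge0// ltW.
  move: i1 i2; rewrite ler_pdivlMr// ltr_pdivrMr// -natr1 mulrDl mul1r => i1 i2.
  by rewrite ger0_norm; lra.
have ys : `|y s - ratr (q i)| <= m.+1%:R^-1.
  rewrite leNgt; apply/negP => ysq.
  pose g r := y (clamp r) - ratr (q i).
  have cg : continuous g.
    by move=> r; apply: cvgB; [exact: continuous_path_clamp|exact: cvg_cst].
  pose V := [set r : R | `|g r| > m.+1%:R^-1] `&` [set r | `|r - i%:R * h n| < h n].
  have oV : open V.
    apply: openI.
      apply: (@open_comp _ _ (fun r => `|g r|) [set r | r > m.+1%:R^-1]).
        by move=> r _; apply: cvg_norm; exact: cg.
      exact: open_gt.
    apply: (@open_comp _ _ (fun r => `|r - i%:R * h n|) [set r | r < h n]).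
      by move=> r _; apply: cvg_norm; apply: cvgB; [exact: cvg_id|exact: cvg_cst].
    exact: open_lt.
  have V0 : V !=set0 by exists (set_val s); split => //=; rewrite /g clampK.
  have [r' [[/= + +] [r _ rE]]] := dense_rat V0 oV.
  rewrite -rE /g => gr ri.
  by have := Cy i r; rewrite size_mkseq nth_mkseq// leNgt gr => /(_ in2 ri).
have xs : `|x s - ratr (q i)| <= m.+1%:R^-1.
  rewrite [leRHS]splitr (le_trans (ler_distD (x (clamp (i%:R * h n))) _ _))//.
  rewrite -{1}[s]clampK.
  by apply: lerD; apply: ltW; [exact: osc|exact: qP].
rewrite (le_lt_trans (ler_distD (ratr (q i)) _ _))// (splitr e).
rewrite (distrC _ (y s)); apply: ltrD; exact: le_lt_trans me.
Qed.

Lemma measurable_borel_path (A : set (borel_path_space t)) :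
  measurable A -> <<s path_cylinders >> A.
Proof.
apply: smallest_sub; last exact: open_path_cylinders.
exact: smallest_sigma_algebra.
Qed.

Lemma measurable_to_path d (S : measurableType d)
    (Phi : S -> borel_path_space t) :
  (forall s, measurable_fun setT (fun w => Phi w s)) -> measurable_fun setT Phi.
Proof.
move=> mPhi _ A /measurable_borel_path; rewrite setTI.
move: A; apply: smallest_sub.
  split => /=.
  - by rewrite preimage_set0.
  - by move=> A mA; rewrite setTD preimage_setC; exact: measurableC.
  - by move=> A mA; rewrite preimage_bigcup; exact: bigcupT_measurable.
move=> _ [s [a [b ->]]] /=.
have := mPhi s measurableT `[a, b]%classic (measurable_itv _); rewrite setTI.
congr measurable; apply/seteqP; split => w /=; by rewrite in_itv.
Qed.

End path_sigma_algebra.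

(** * One-dimensional Gaussian integrals *)

Section lebesgue_translation.
Context {R : realType}.
Local Notation mu := lebesgue_measure.

Lemma lebesgue_measure_shift (u : R) (A : set R) : measurable A ->
  pushforward mu ((fun x => x + u) : _ -> measurableTypeR R) A = mu A.
Proof.
move=> mA.
pose f : R -> measurableTypeR R := fun x => x + u.
have mf : measurable_fun setT f by exact: measurable_funD.
pose shift : {mfun R >-> measurableTypeR R} :=
  HB.pack f (isMeasurableFun.Build _ _ _ _ f mf).
apply/esym/(@lebesgue_measure_unique _ (pushforward mu shift)) => //.
move=> _ [[a b]] _ <-.
have E : f @^-1` `]a, b]%classic = `](a - u), (b - u)]%classic.
  by apply/seteqP; split => x /=; rewrite !in_itv/= ltrBlDr lerBrDr.
transitivity (mu `](a - u), (b - u)]%classic); last by rewrite -E.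
rewrite /= !lebesgue_measure_itv/= !lte_fin ltrD2r.
by case: ifP => // _; rewrite -!EFinD; congr EFin; ring.
Qed.

Lemma ge0_integral_shift (u : R) (f : R -> \bar R) : measurable_fun setT f ->
  (forall x, 0 <= f x)%E -> (\int[mu]_x f (x + u)%R = \int[mu]_x f x)%E.
Proof.
move=> mf f0.
have mshift : measurable_fun setT ((fun x => x + u) : R -> measurableTypeR R).
  exact: measurable_funD.
transitivity
  (\int[pushforward mu ((fun x => x + u)%R : R -> measurableTypeR R)]_x f x)%E.
  by rewrite ge0_integral_pushforward.
by apply: eq_measure_integral => //= A mA _; exact: lebesgue_measure_shift.
Qed.

End lebesgue_translation.

Section gaussian_integrals.
Context {R : realType}.
Local Notation mu := lebesgue_measure.
Import HBNNSimple.

(** Both sides agree on simple functions; the general case is monotone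
    convergence. *)
Lemma ge0_integral_normal_prob (m s : R) (f : R -> \bar R) :
  measurable_fun setT f -> (forall x, 0 <= f x)%E ->
  (\int[normal_prob m s]_x f x = \int[mu]_x (f x * (normal_pdf m s x)%:E))%E.
Proof.
move=> mf f0.
have mpdf : measurable_fun setT (fun x => (normal_pdf m s x)%:E).
  by apply/measurable_EFinP; exact: measurable_normal_pdf.
have pdf0 x : (0 <= (normal_pdf m s x)%:E)%E by rewrite lee_fin normal_pdf_ge0.
pose f_ := @nnsfun_approx _ (measurableTypeR R) R setT measurableT f mf.
have nd x : {homo (fun n => (f_ n x)%:E) : a b / (a <= b)%N >-> (a <= b)%E}.
  by move=> a b ab; rewrite lee_fin; exact/lefP/nd_nnsfun_approx.
have f_cvg x : (f_ n x)%:E @[n --> \oo] --> f x.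
  by apply: cvg_nnsfun_approx.
have mf_ n : measurable_fun setT (fun x => (f_ n x)%:E).
  exact/measurable_EFinP/measurable_funP.
have sfun_case n : (\int[normal_prob m s]_x (f_ n x)%:E =
    \int[mu]_x ((f_ n x)%:E * (normal_pdf m s x)%:E))%E.
  have mset r : measurable (f_ n @^-1` [set r]) by [].
  transitivity (\int[mu]_x \sum_(k \in range (f_ n))
      (k%:E * (\1_(f_ n @^-1` [set k]) x)%:E * (normal_pdf m s x)%:E))%E.
    rewrite integralT_nnsfun sintegralE ge0_integral_fsum//; last 2 first.
    - move=> r; apply: emeasurable_funM => //.
      by apply/measurable_EFinP/measurable_funM.
    - move=> r x _; rewrite mule_ge0// -EFinM lee_fin.
      exact: nnfun_muleindic_ge0.
    apply: eq_fsbigr => r /[!inE] -[y _ yr].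
    rewrite /normal_prob [X in (_ * X)%E = _]integral_mkcond/=.
    under [RHS]eq_integral do rewrite -muleA.
    rewrite ge0_integralZl//; last 3 first.
    - by apply: emeasurable_funM => //; apply/measurable_EFinP.
    - by move=> x _; rewrite mule_ge0// lee_fin.
    - by rewrite lee_fin -yr.
    congr (_ * _)%E; apply: eq_integral => x _.
    by rewrite patchE indicE; case: ifPn; rewrite ?mul1e ?mul0e.
  apply: eq_integral => x _.
  rewrite [in RHS](fimfunE (f_ n)) -fsumEFin// ge0_mule_fsuml//.
  by move=> r; rewrite lee_fin; exact: nnfun_muleindic_ge0.
transitivity (limn (fun n => \int[normal_prob m s]_x (f_ n x)%:E)%E).
  rewrite -monotone_convergence//; last by move=> n x _; rewrite lee_fin.
  by apply: eq_integral => x _; apply/esym/cvg_lim.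
transitivity (limn (fun n => \int[mu]_x ((f_ n x)%:E * (normal_pdf m s x)%:E))%E).
  by congr (limn _); apply/funext.
rewrite -monotone_convergence//; last 3 first.
- by move=> n; apply: emeasurable_funM.
- by move=> n x _; rewrite mule_ge0// lee_fin.
- by move=> x _ a b ab; rewrite lee_wpmul2r//; exact: nd.
apply: eq_integral => x _; apply: cvg_lim => //.
by apply: cvgeZr => //; exact: f_cvg.
Qed.

(** The Cameron-Martin formula in dimension one: the exponential is the ratio of
    the Gaussian densities at x + u and at x, and Lebesgue measure is invariant under
    translation. *)
Lemma gaussian_shift (s u : R) (k : R -> \bar R) : 0 < s ->
  measurable_fun setT k -> (forall x, 0 <= k x)%E ->
  (\int[normal_prob 0 s]_x
     ((expR (- (u * x / s ^+ 2) - u ^+ 2 / (2 * s ^+ 2)))%:E * k (x + u)%R) =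
   \int[normal_prob 0 s]_x k x)%E.
Proof.
move=> s0 mk k0; have sn0 : s != 0 by rewrite gt_eqF.
rewrite !ge0_integral_normal_prob//; last 2 first.
- apply: emeasurable_funM.
    apply/measurable_EFinP; apply: measurableT_comp => //.
    apply: measurable_funB => //; apply: measurable_funN.
    by apply: measurable_funM => //; apply: measurable_funM.
  by apply: (measurableT_comp mk); exact: measurable_funD.
- by move=> x; rewrite mule_ge0// lee_fin expR_ge0.
rewrite -[RHS](@ge0_integral_shift _ u); last 2 first.
- apply: emeasurable_funM => //; apply/measurable_EFinP.
  exact: measurable_normal_pdf.
- by move=> x; rewrite mule_ge0// lee_fin normal_pdf_ge0.
apply: eq_integral => x _.
rewrite muleAC muleC; congr (_ * _)%E; rewrite -EFinM; congr EFin.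
rewrite normal_pdfE// mulrCA; congr (_ * _).
rewrite /normal_fun -expRD; congr expR.
by field.
Qed.

(** The exponential of a square turns the Gaussian density into a multiple of the
    one with standard deviation s / sqrt (1 - 2 c). *)
Lemma gaussian_exp_square (s c : R) : 0 < s -> c < 1 / 2 ->
  (\int[normal_prob 0 s]_x (expR (c * x ^+ 2 / s ^+ 2))%:E =
   ((Num.sqrt (1 - 2 * c))^-1)%:E)%E.
Proof.
move=> s0 c2; have sn0 : s != 0 by rewrite gt_eqF.
have c0 : 0 < 1 - 2 * c by lra.
set q := Num.sqrt (1 - 2 * c).
have q0 : 0 < q by rewrite sqrtr_gt0.
have q2 : q ^+ 2 = 1 - 2 * c by rewrite sqr_sqrtr// ltW.
pose s' := s / q; have s'0 : s' != 0 by rewrite mulf_neq0// invr_eq0 gt_eqF.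
rewrite ge0_integral_normal_prob//; last first.
  apply/measurable_EFinP; apply: measurableT_comp => //.
  by apply: measurable_funM => //; apply: measurable_funM.
transitivity (\int[mu]_x ((q^-1)%:E * (normal_pdf 0 s' x)%:E))%E.
  apply: eq_integral => x _; rewrite -!EFinM; congr EFin.
  rewrite !normal_pdfE//.
  have -> : normal_peak s' = q * normal_peak s.
    rewrite /normal_peak /s'.
    rewrite expr_div_n -exprVn (mulrC (s ^+ 2)) -mulrA -mulrnAr.
    by rewrite sqrtrM ?sqr_ge0// sqrtr_sqr gtr0_norm ?invr_gt0// invfM invrK.
  rewrite mulrCA !mulrA mulVf ?gt_eqF// mul1r -mulrA; congr (_ * _).
  rewrite /normal_fun -expRD; congr expR; rewrite /s' expr_div_n q2.
  by field; rewrite sn0 gt_eqF.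
rewrite ge0_integralZl_EFin//.
- by rewrite integral_normal_pdf mule1.
- by move=> x _; rewrite lee_fin normal_pdf_ge0.
- by apply/measurable_EFinP; exact: measurable_normal_pdf.
- by rewrite invr_ge0 ltW.
Qed.

End gaussian_integrals.

(** * Independent noises and the discrete change of drift *)

Section real_sequences.
Context {R : realType}.

(** All coordinates are constrained at once: this is still a family stable under
    intersection, it generates the product sigma-algebra, and no bound on the number
    of coordinates has to be carried around. *)
Definition rectangles : set (set (nat -> R)) :=
  [set C | exists2 A : nat -> set R, (forall i, measurable (A i)) &
    C = [set y | forall i, A i (y i)]].

Definition real_seq : Type := g_sigma_algebraType rectangles.
HB.instance Definition _ := Measurable.on real_seq.

Lemma measurable_real_seq_coord (i : nat) :
  measurable_fun setT (fun y : real_seq => y i : R).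
Proof.
move=> _ A mA; rewrite setTI; apply: sub_sigma_algebra.
exists (fun j => if j == i then A else setT).
  by move=> j; case: ifP.
apply/seteqP; split => y /=; first by move=> Ay j; case: eqP => [->|].
by move=> /(_ i); rewrite eqxx.
Qed.

Lemma measurable_to_real_seq d (X : measurableType d) (Phi : X -> real_seq) :
  (forall i, measurable_fun setT (fun x => Phi x i : R)) ->
  measurable_fun setT Phi.
Proof.
move=> mPhi; apply: (@measurability _ _ X real_seq setT Phi rectangles) => //.
move=> _ [_ [A mA ->] <-]; rewrite setTI.
rewrite (_ : _ @^-1` _ = \bigcap_i ((fun x => Phi x i : R) @^-1` A i)).
  apply: bigcapT_measurable => i; rewrite -[_ @^-1` _]setTI.
  exact: mPhi.
by apply/seteqP; split => x /=; [move=> h i _; exact: h|move=> h i; exact: h].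
Qed.

End real_sequences.
Arguments real_seq : clear implicits.

Section iid_noise.
Context d (Omega : measurableType d) (R : realType) (P : probability Omega R).
Variables (N : probability R R) (xi : nat -> {RV P >-> R}).
Hypothesis xi_law : forall i A, measurable A -> P (xi i @^-1` A) = N A.
Hypothesis xi_indep : forall n (A : nat -> set R), (forall i, measurable (A i)) ->
  P (\bigcap_(i < n) xi i @^-1` A i) =
  \big[mule/1%E]_(i < n) P (xi i @^-1` A i).

(** Padding with zeros keeps the pasts of all lengths in a single type. *)
Definition past (n : nat) (w : Omega) : real_seq R :=
  fun i => if (i < n)%N then xi i w else 0.

Lemma measurable_past n : measurable_fun setT (past n).
Proof.
by apply: measurable_to_real_seq => i; rewrite /past; case: ltnP.
Qed.

(** Both sides are finite measures in C, so it suffices to compare them on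
    rectangles.  Because of the padding, the preimage of a rectangle is empty unless
    all its sides of index at least n contain 0, and otherwise it is a finite
    intersection to which the independence hypothesis applies. *)
Lemma past_indep n (C : set (real_seq R)) (A : set R) :
  measurable C -> measurable A ->
  P (past n @^-1` C `&` xi n @^-1` A) = (P (past n @^-1` C) * N A)%E.
Proof.
move=> mC mA.
have mxA : measurable (xi n @^-1` A).
  by rewrite -[_ @^-1` _]setTI; exact: measurable_funPT.
pose pst : {mfun Omega >-> real_seq R} :=
  HB.pack (past n) (isMeasurableFun.Build _ _ _ _ _ (measurable_past n)).
pose m1 : {measure set (real_seq R) -> \bar R} :=
  pushforward (mrestr P mxA) pst.
have fN : N A \is a fin_num by exact: fin_num_measure.
have N0 : 0 <= fine (N A) by rewrite fine_ge0.
pose m2 : {measure set (real_seq R) -> \bar R} :=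
  mscale (NngNum N0) (pushforward P pst).
have mpast := measurable_past n.
suff : m1 mpast C = m2 mpast C.
  by rewrite /m1 /m2/= /mscale/= /pushforward /mrestr/= fineK// muleC.
apply: (@measure_unique _ _ (real_seq R) rectangles (fun=> setT) _ _ _ _
  (m1 mpast) (m2 mpast)) => //.
- move=> _ _ [A1 mA1 ->] [A2 mA2 ->]; exists (fun i => A1 i `&` A2 i).
    by move=> i; exact: measurableI.
  apply/seteqP; split => y /=; first by case=> h1 h2 i; split.
  by move=> h; split=> i; case: (h i).
- by move=> _; exists (fun=> setT) => //; apply/seteqP; split.
- by rewrite bigcup_const.
- move=> _ [D mD ->]; rewrite /m1 /m2/= /mscale/= /pushforward /mrestr/= fineK//.
  have [D0|D0] := pselect (forall i, (n <= i)%N -> D i 0); last first.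
    rewrite (_ : past n @^-1` _ = set0) ?set0I ?measure0 ?mule0//.
    apply/seteqP; split => // w /= Dw; apply: D0 => i ni.
    by have := Dw i; rewrite /past ltnNge ni.
  pose D' i := if i == n then A else D i.
  have mD' i : measurable (D' i) by rewrite /D'; case: ifP.
  have pE : past n @^-1` [set y | forall i, D i (y i)] =
      \bigcap_(i < n) xi i @^-1` D i.
    apply/seteqP; split => w /= Dw.
      by move=> i /= i_n; have := Dw i; rewrite /past i_n.
    by move=> i; rewrite /past; case: ltnP => [/Dw//|/D0].
  transitivity (P (\bigcap_(i < n.+1) xi i @^-1` D' i)).
    congr (P _); rewrite pE; apply/seteqP; split => w /=.
      move=> [Dw Aw] i /=; rewrite ltnS leq_eqVlt /D' => /orP[/eqP ->|i_n].
        by rewrite eqxx.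
      by rewrite ltn_eqF//; exact: Dw.
    move=> Dw; split; last by have := Dw n (ltnSn n); rewrite /D' eqxx.
    by move=> i /= i_n; have := Dw i (ltnW i_n); rewrite /D' ltn_eqF.
  rewrite xi_indep// big_ord_recr/= {2}/D' eqxx xi_law// muleC; congr (_ * _)%E.
  rewrite pE xi_indep//; apply: eq_bigr => i _.
  by rewrite /D' ltn_eqF.
- move=> _; rewrite /m1/= /pushforward /mrestr preimage_setT setTI.
  by rewrite (le_lt_trans (probability_le1 _ mxA))// ltry.
Qed.

(** The joint law of the past and of the next noise is a product measure, since it
    is one on products of measurable sets; then apply Tonelli's theorem. *)
Lemma integral_fresh_noise n (Psi : real_seq R * R -> \bar R) :
  measurable_fun setT Psi -> (forall z, 0 <= Psi z)%E ->
  (\int[P]_w Psi (past n w, xi n w) = \int[P]_w \int[N]_x Psi (past n w, x))%E.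
Proof.
move=> mPsi Psi0.
pose pst : {mfun Omega >-> real_seq R} :=
  HB.pack (past n) (isMeasurableFun.Build _ _ _ _ _ (measurable_past n)).
have mpair : measurable_fun setT (fun w => (past n w, xi n w)).
  by apply: measurable_fun_pair => //; exact: measurable_past.
pose pr : {mfun Omega >-> (real_seq R * R)%type} :=
  HB.pack (fun w => (past n w, xi n w)) (isMeasurableFun.Build _ _ _ _ _ mpair).
rewrite -(@ge0_integral_distribution _ _ _ _ _ P pr Psi)//.
transitivity (\int[(distribution P pst) \x N]_z Psi z)%E.
  apply: eq_measure_integral => A mA _; apply/esym.
  apply: product_measure_unique => // C D mC mD.
  by rewrite -past_indep.
rewrite fubini_tonelli1// /fubini_F.
rewrite (@ge0_integral_distribution _ _ _ _ _ P pst)//.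
- exact: measurable_fun_fubini_tonelli_F.
- by move=> y; exact: integral_ge0.
Qed.

Lemma integral_prod_noise (g : R -> R) (k : R) n :
  measurable_fun setT g -> (forall x, 0 <= g x) ->
  (\int[N]_x (g x)%:E = k%:E)%E ->
  (\int[P]_w (\prod_(i < n) g (xi i w))%:E = (k ^+ n)%:E)%E.
Proof.
move=> mg g0 gk.
have mprod m : measurable_fun setT
    (fun y : real_seq R => \prod_(i < m) g (y i)).
  apply: measurable_prod => i _; apply: (measurableT_comp mg).
  exact: measurable_real_seq_coord.
elim: n => [|n IH].
  under eq_integral do rewrite big_ord0.
  by rewrite integral_cst// [X in (_ * X)%E](@probability_setT _ _ _ P) mule1.
pose Psi (z : real_seq R * R) := ((\prod_(i < n) g (z.1 i)) * g z.2)%:E.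
transitivity (\int[P]_w Psi (past n w, xi n w))%E.
  apply: eq_integral => w _; rewrite /Psi/= big_ord_recr/=; congr (_ * _)%:E.
  by apply: eq_bigr => i _; rewrite /past/= ltn_ord.
rewrite (@integral_fresh_noise n Psi); last 2 first.
- apply/measurable_EFinP; apply: measurable_funM.
    by apply: (measurableT_comp (mprod n)).
  by apply: (measurableT_comp mg).
- by move=> z; rewrite lee_fin mulr_ge0// prodr_ge0.
transitivity (\int[P]_w (k%:E * (\prod_(i < n) g (xi i w))%:E))%E.
  apply: eq_integral => w _; rewrite /Psi/=.
  under eq_integral do rewrite EFinM.
  rewrite ge0_integralZl_EFin//; last 3 first.
  - by move=> x _; rewrite lee_fin.
  - exact/measurable_EFinP.
  - by rewrite prodr_ge0.
  rewrite gk muleC; congr (_ * _%:E)%E.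
  by apply: eq_bigr => i _; rewrite /past ltn_ord.
have k0 : 0 <= k.
  by rewrite -lee_fin -gk; apply: integral_ge0 => x _; rewrite lee_fin.
rewrite ge0_integralZl_EFin//; first by rewrite IH -EFinM exprS.
- by move=> w _; rewrite lee_fin prodr_ge0.
- apply/measurable_EFinP; apply: measurable_prod => i _.
  exact: (measurableT_comp mg).
Qed.

Fixpoint euler (b : nat -> R) (sigma : R) (x : nat -> R) (n : nat) : R :=
  if n is n'.+1 then b n' * euler b sigma x n' + sigma * x n' else 0.

Lemma eq_euler b sigma (x y : nat -> R) n :
  (forall i, (i < n)%N -> x i = y i) -> euler b sigma x n = euler b sigma y n.
Proof.
elim: n => // n IH xy /=; rewrite IH ?xy// => i i_n.
by apply: xy; exact: ltnW.
Qed.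

Lemma measurable_euler b sigma n :
  measurable_fun setT (fun x : real_seq R => euler b sigma x n).
Proof.
elim: n => //= n IH; apply: measurable_funD; first exact: measurable_funM.
by apply: measurable_funM => //; exact: measurable_real_seq_coord.
Qed.

Definition stop (n : nat) (y : nat -> R) : real_seq R :=
  fun i => if (i <= n)%N then y i else 0.

Let extend (n : nat) (z : real_seq R * R) : real_seq R :=
  fun i => if i == n.+1 then z.2 else z.1 i.

Let measurable_extend n : measurable_fun setT (extend n).
Proof.
apply: measurable_to_real_seq => i; rewrite /extend; case: eqP => _.
  exact: measurable_snd.
exact: (measurableT_comp (@measurable_real_seq_coord _ i) measurable_fst).
Qed.

Let stopS n y : stop n.+1 y = extend n (stop n y, y n.+1).
Proof.
apply/funext => i; rewrite /stop /extend/=; case: eqP => [->|/eqP ni].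
  by rewrite leqnn.
by rewrite leq_eqVlt (negbTE ni) ltnS.
Qed.

Section change_of_drift.
Variables (h sigma : R) (b1 b2 : nat -> R).
Hypothesis sigma_neq0 : sigma != 0.

(** Ratio of the densities at x + u and at x of the centred Gaussian law with
    variance h. *)
Definition shift_density (u x : R) : R :=
  expR (- (u * x / h) - u ^+ 2 / (2 * h)).

Hypothesis N_shift : forall (u : R) (k : R -> \bar R),
  measurable_fun setT k -> (forall x, 0 <= k x)%E ->
  (\int[N]_x ((shift_density u x)%:E * k (x + u)%R) = \int[N]_x k x)%E.

(** The translation of the i-th noise that turns a step of the first scheme into a
    step of the second one started from the same point. *)
Definition drift_gap (x : nat -> R) (i : nat) : R :=
  (b1 i - b2 i) * euler b1 sigma x i / sigma.

Definition drift_density (n : nat) (x : nat -> R) : R :=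
  \prod_(i < n) shift_density (drift_gap x i) (x i).

Let measurable_drift_gap i :
  measurable_fun setT (fun x : real_seq R => drift_gap x i).
Proof.
by apply: measurable_funM => //; apply: measurable_funM => //; exact: measurable_euler.
Qed.

Let measurable_shift_density d' (X : measurableType d') (f g : X -> R) :
  measurable_fun setT f -> measurable_fun setT g ->
  measurable_fun setT (fun x => shift_density (f x) (g x)).
Proof.
move=> mf mg; apply: measurableT_comp => //; apply: measurable_funB.
  apply: measurable_funN; apply: measurable_funM => //.
  exact: measurable_funM.
by apply: measurable_funM => //; exact: measurable_funX.
Qed.

Lemma measurable_drift_density n :
  measurable_fun setT (fun x : real_seq R => drift_density n x).
Proof.
apply: measurable_prod => i _; apply: measurable_shift_density => //.
exact: measurable_real_seq_coord.
Qed.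

Lemma drift_density_ge0 n x : 0 <= drift_density n x.
Proof. by apply: prodr_ge0 => i _; exact: expR_ge0. Qed.

Lemma measurable_stop_euler b n :
  measurable_fun setT (fun x : real_seq R => stop n (euler b sigma x)).
Proof.
apply: measurable_to_real_seq => i; rewrite /stop; case: leqP => // _.
exact: measurable_euler.
Qed.

Let xs (w : Omega) : nat -> R := fun i => xi i w.

(** The discrete Girsanov formula, by induction on the number of steps.  Conditionally
    on the past, the last factor of the density translates the last noise and so
    replaces the last step of the first scheme by a step of the second one.  What
    remains is a functional of one coordinate less, to which the induction hypothesis
    applies. *)
Lemma change_of_drift n (f : real_seq R -> \bar R) :
  measurable_fun setT f -> (forall y, 0 <= f y)%E ->
  (\int[P]_w ((drift_density n (xs w))%:E * f (stop n (euler b1 sigma (xs w)))) =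
   \int[P]_w f (stop n (euler b2 sigma (xs w))))%E.
Proof.
elim: n f => [f mf f0|n IH f mf f0].
  apply: eq_integral => w _; rewrite /drift_density big_ord0 mul1e; congr f.
  by apply/funext => i; rewrite /stop; case: i.
have euler_past b w i : (i <= n)%N ->
    euler b sigma (past n w) i = euler b sigma (xs w) i.
  by move=> i_n; apply: eq_euler => j ji; rewrite /past (leq_trans ji).
have stop_past b w :
    stop n (euler b sigma (past n w)) = stop n (euler b sigma (xs w)).
  by apply/funext => i; rewrite /stop; case: leqP => // /euler_past.
have dens_past w : drift_density n (past n w) = drift_density n (xs w).
  apply: eq_bigr => i _; rewrite /drift_gap euler_past ?(ltnW (ltn_ord i))//.
  by rewrite /past ltn_ord.
have gap_past w : drift_gap (past n w) n = drift_gap (xs w) n.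
  by rewrite /drift_gap euler_past.
have mnext b : measurable_fun setT (fun z : real_seq R * R =>
    f (extend n (stop n (euler b sigma z.1),
                 b n * euler b sigma z.1 n + sigma * z.2))).
  apply: (measurableT_comp mf); apply: (measurableT_comp (measurable_extend n)).
  apply: measurable_fun_pair.
    exact: (measurableT_comp (measurable_stop_euler b n)).
  apply: measurable_funD; apply: measurable_funM => //.
  exact: (measurableT_comp (measurable_euler b sigma n)).
pose g (y : real_seq R) : \bar R :=
  (\int[N]_s f (extend n (y, b2 n * y n + sigma * s)%R))%E.
have mg : measurable_fun setT g.
  apply: (@measurable_fun_fubini_tonelli_F _ _ _ _ _ N
    (fun z : real_seq R * R => f (extend n (z.1, b2 n * z.1 n + sigma * z.2)))) => //.
  apply: (measurableT_comp mf); apply: (measurableT_comp (measurable_extend n)).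
  apply: measurable_fun_pair => //.
  apply: measurable_funD; apply: measurable_funM => //.
  exact: (measurableT_comp (@measurable_real_seq_coord _ n)).
have g0 y : (0 <= g y)%E by exact: integral_ge0.
pose Psi1 (z : real_seq R * R) : \bar R :=
  ((drift_density n z.1 * shift_density (drift_gap z.1 n) z.2)%:E *
    f (extend n (stop n (euler b1 sigma z.1),
                 (b1 n * euler b1 sigma z.1 n + sigma * z.2)%R)))%E.
transitivity (\int[P]_w Psi1 (past n w, xi n w))%E.
  apply: eq_integral => w _.
  rewrite /Psi1/= stopS /= stop_past dens_past gap_past euler_past//.
  by rewrite {1}/drift_density big_ord_recr.
rewrite (@integral_fresh_noise n Psi1); last 2 first.
- apply: emeasurable_funM => //; apply/measurable_EFinP; apply: measurable_funM.
    exact: (measurableT_comp (measurable_drift_density n)).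
  apply: measurable_shift_density => //.
  exact: (measurableT_comp (measurable_drift_gap n)).
- by move=> z; rewrite mule_ge0// lee_fin mulr_ge0 ?drift_density_ge0 ?expR_ge0.
transitivity (\int[P]_w ((drift_density n (xs w))%:E *
    g (stop n (euler b1 sigma (xs w)))))%E.
  apply: eq_integral => w _; rewrite /Psi1/= stop_past dens_past gap_past euler_past//.
  set y := stop n (euler b1 sigma (xs w)).
  have yn : y n = euler b1 sigma (xs w) n by rewrite /y /stop leqnn.
  set u := drift_gap (xs w) n.
  pose k s := f (extend n (y, b2 n * y n + sigma * s)).
  have mk : measurable_fun setT k.
    apply: (measurableT_comp mf); apply: (measurableT_comp (measurable_extend n)).
    apply: measurable_fun_pair => //.
    by apply: measurable_funD => //; apply: measurable_funM.
  have k0 s : (0 <= k s)%E by exact: f0.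
  rewrite /g -/(k _) -(N_shift u mk k0)//.
  rewrite -ge0_integralZl_EFin//; last 3 first.
  - by move=> s _; apply: mule_ge0; [rewrite lee_fin expR_ge0|exact: f0].
  - apply: emeasurable_funM.
      by apply/measurable_EFinP; exact: measurable_shift_density.
    by apply: (measurableT_comp mk); exact: measurable_funD.
  - exact: drift_density_ge0.
  apply: eq_integral => s _; rewrite EFinM muleA; congr (_ * _)%E.
  rewrite /k; congr (f (extend n (_, _))); rewrite yn /u /drift_gap.
  by field.
apply: (etrans (IH g mg g0)).
pose Psi2 (z : real_seq R * R) : \bar R :=
  f (extend n (stop n (euler b2 sigma z.1),
               b2 n * euler b2 sigma z.1 n + sigma * z.2)).
transitivity (\int[P]_w Psi2 (past n w, xi n w))%E; last first.
  apply: eq_integral => w _.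
  by rewrite /Psi2/= stopS /= stop_past euler_past.
rewrite (@integral_fresh_noise n Psi2); last 2 first.
- exact: mnext.
- by move=> z; exact: f0.
apply: eq_integral => w _; rewrite /Psi2/= stop_past euler_past//.
by rewrite /g {2}/stop leqnn.
Qed.

End change_of_drift.

End iid_noise.

(** * Euler schemes and quadratic variation along a path *)

Section pathwise_drift.
Context {R : realType}.
Local Notation mu := (@lebesgue_measure R).

Lemma integral_close_to_cst (g : R -> R) (u v c e : R) : u <= v ->
  mu.-integrable `]u, v] (EFin \o g) ->
  (forall r, u <= r <= v -> `|g r - c| <= e) ->
  `|(\int[mu]_(r in `]u, v]) g r) - c * (v - u)| <= e * (v - u).
Proof.
move=> uv ig gc.
have cst_int (k : R) : \int[mu]_(r in `]u, v]) k = k * (v - u).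
  rewrite Rintegral_cst// [X in fine X]lebesgue_measure_itv/= lte_fin.
  move: uv; rewrite le_eqVlt => /predU1P[->|->//].
  by rewrite ltxx subrr.
have icst (k : R) : mu.-integrable `]u, v] (EFin \o (fun=> k)).
  apply: (@integrableS _ _ _ mu `[u, v]%classic) => //.
    by move=> r /=; rewrite !in_itv/= => /andP[/ltW -> ->].
  apply: continuous_compact_integrable; first exact: segment_compact.
  by apply: continuous_subspaceT; exact: cst_continuous.
have idiff : mu.-integrable `]u, v] (EFin \o (fun r => g r - c)).
  have := @integrableB _ _ _ mu `]u, v]%classic (measurable_itv _) _ _ ig (icst c).
  by apply: eq_integrable.
rewrite -cst_int -RintegralB//.
apply: (le_trans (le_normr_Rintegral _ _)) => //.
rewrite -cst_int; apply: le_Rintegral => //; first exact: integrable_norm idiff.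
by move=> r /=; rewrite in_itv/= => /andP[ur rv]; apply: gc; rewrite (ltW ur).
Qed.

Variables (T t alpha sigma : R) (x b : R -> R).
Hypothesis t_gt0 : 0 < t.
Hypothesis tT : t < T.
Hypothesis cx : {within `[0, t], continuous x}.
Hypothesis cb : {within `[0, t], continuous b}.
Hypothesis x0 : x 0 = 0.

Definition lin_drift (s : R) : R := - (alpha / (T - s)) * x s.

Hypothesis x_sde : forall s, 0 <= s <= t ->
  x s = \int[mu]_(r in `[0, s]) lin_drift r + sigma * (b s - b 0).

Lemma rate_bound (a s : R) : s <= t -> `|a / (T - s)| <= `|a| / (T - t).
Proof.
move=> st; have Ts : 0 < T - s by rewrite subr_gt0 (le_lt_trans st).
rewrite normrM normfV (gtr0_norm Ts).
by rewrite ler_wpM2l// lef_pV2 ?posrE// ?lerD2l ?lerN2// subr_gt0.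
Qed.

Lemma lin_drift_continuous : {within `[0, t], continuous lin_drift}.
Proof.
apply/subspace_continuousP => s st; have st' := st.
move: st'; rewrite /= in_itv/= => /andP[s0 s_t].
apply: cvgM; last by move/subspace_continuousP: cx; apply.
apply: cvgN; apply: cvgM; first exact: cvg_cst.
apply: cvg_within_filter.
apply: cvgV; first by rewrite subr_eq0 gt_eqF// (le_lt_trans s_t).
by apply: cvgB; [exact: cvg_cst|exact: cvg_id].
Qed.

Let integrable_lin_drift u v : 0 <= u -> v <= t ->
  mu.-integrable `]u, v] (EFin \o lin_drift).
Proof.
move=> u0 vt; apply: (@integrableS _ _ _ mu `[0, t]%classic) => //.
  move=> r /=; rewrite !in_itv/= => /andP[ur rv].
  by rewrite (le_trans u0 (ltW ur)) (le_trans rv vt).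
apply: continuous_compact_integrable; first exact: segment_compact.
exact: lin_drift_continuous.
Qed.

Let integrable_lin_drift0 v : v <= t ->
  mu.-integrable `[0, v] (EFin \o lin_drift).
Proof.
move=> vt; apply: (@integrableS _ _ _ mu `[0, t]%classic) => //.
  by move=> r /=; rewrite !in_itv/= => /andP[-> rv]; rewrite (le_trans rv vt).
apply: continuous_compact_integrable; first exact: segment_compact.
exact: lin_drift_continuous.
Qed.

Lemma solution_increment u v : 0 <= u -> u <= v -> v <= t ->
  x v - x u = \int[mu]_(r in `]u, v]) lin_drift r + sigma * (b v - b u).
Proof.
move=> u0 uv vt.
rewrite (x_sde (s := v)) ?(le_trans u0 uv)// (x_sde (s := u)) ?u0 ?(le_trans uv)//.
rewrite -(@Rintegral_itvB _ lin_drift (BLeft 0) (BRight v) u)//.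
- by ring.
- exact: integrable_lin_drift0.
Qed.

Lemma path_bounded : exists2 M : R, 0 < M & forall s, 0 <= s <= t -> `|x s| <= M.
Proof.
have : compact (x @` `[0, t]).
  by apply: continuous_compact => //; exact: segment_compact.
move=> /compact_bounded[M [Mr xM]].
exists (`|M| + 1); first by rewrite ltr_wpDl.
move=> s st; apply: (xM (`|M| + 1)).
  by rewrite (le_lt_trans (ler_norm M))// ltrDl.
by exists s => //=; rewrite in_itv.
Qed.

Section grid.
Variable n : nat.
Let h := t / n.+1%:R.

Definition grid_noise (i : nat) : R := b (i.+1%:R * h) - b (i%:R * h).
Definition euler_coef (i : nat) : R := 1 - h * (alpha / (T - i%:R * h)).

Lemma grid_step_gt0 : 0 < h. Proof. by rewrite divr_gt0. Qed.

Lemma grid_in i : (i <= n.+1)%N -> 0 <= i%:R * h <= t.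
Proof.
move=> i_n; rewrite mulr_ge0 ?(ltW grid_step_gt0)//=.
by rewrite mulrA ler_pdivrMr// mulrC ler_pM2l// ler_nat.
Qed.

(** Discrete Gronwall: one step multiplies the error by at most 1 + h L, with L a
    bound on the rate |alpha| / (T - s), and adds at most h w, where w bounds the
    oscillation of the drift over one step. *)
Lemma euler_error (w : R) :
  (forall r s, 0 <= r <= t -> 0 <= s <= t -> `|r - s| <= h ->
    `|lin_drift r - lin_drift s| <= w) ->
  forall i, (i <= n.+1)%N ->
  `|euler euler_coef sigma grid_noise i - x (i%:R * h)| <=
    i%:R * h * w * (1 + h * (`|alpha| / (T - t))) ^+ i.
Proof.
move=> gw; have h0 := grid_step_gt0; set L := `|alpha| / (T - t).
have L0 : 0 <= L by rewrite divr_ge0// subr_ge0 ltW.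
have w0 : 0 <= w by apply: le_trans (gw 0 0 _ _ _); rewrite ?subrr ?normr0 ?lexx ?ltW.
elim=> [_|i IH i_n]; first by rewrite !mul0r x0 subrr normr0.
have /andP[u0 ut] := grid_in (ltnW i_n).
have /andP[v0 vt] := grid_in i_n.
have vu : i.+1%:R * h - i%:R * h = h by rewrite -mulrBl -natrB// subSnn mul1r.
have uv : i%:R * h <= i.+1%:R * h by rewrite -subr_ge0 vu ltW.
have := solution_increment u0 uv vt.
set I := (\int[mu]_(r in _) _) => incr.
have IE : `|I - lin_drift (i%:R * h) * h| <= w * h.
  have := @integral_close_to_cst lin_drift _ _ (lin_drift (i%:R * h)) w uv.
  rewrite vu; apply; first exact: integrable_lin_drift.
  move=> r /andP[ur rv]; apply: gw.
  - by rewrite (le_trans u0 ur) (le_trans rv vt).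
  - exact/andP.
  by rewrite ger0_norm ?subr_ge0// -[leRHS]vu lerD2r.
set y := euler _ _ _ in IH *.
have -> : y i.+1 - x (i.+1%:R * h) =
    (y i - x (i%:R * h)) * (1 - h * (alpha / (T - i%:R * h))) -
    (I - lin_drift (i%:R * h) * h).
  rewrite /y/= /grid_noise /euler_coef -/y.
  have -> : x (i.+1%:R * h) = x (i%:R * h) + I +
      sigma * (b (i.+1%:R * h) - b (i%:R * h)) by lra.
  by rewrite /lin_drift; ring.
have fac : `|1 - h * (alpha / (T - i%:R * h))| <= 1 + h * L.
  rewrite (le_trans (ler_normB _ _))// normr1 lerD2l normrM gtr0_norm//.
  by rewrite ler_pM2l// rate_bound.
have hL1 : 1 <= 1 + h * L by rewrite lerDl mulr_ge0// ltW.
rewrite (le_trans (ler_normB _ _))// normrM.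
have step1 : `|y i - x (i%:R * h)| * `|1 - h * (alpha / (T - i%:R * h))| <=
    i%:R * h * w * (1 + h * L) ^+ i.+1.
  by rewrite exprSr [leRHS]mulrA; apply: ler_pM => //; exact: (IH (ltnW i_n)).
rewrite (le_trans (lerD step1 IE))//.
rewrite -natr1 mulrDl mul1r mulrDl mulrDl lerD2l (mulrC w).
apply: ler_peMr; first by rewrite mulr_ge0// ltW.
exact: exprn_ege1.
Qed.

End grid.

Lemma euler_cvg (e : R) : 0 < e -> \forall n \near \oo,
  forall i, (i <= n.+1)%N ->
  `|euler (euler_coef n) sigma (grid_noise n) i - x (i%:R * (t / n.+1%:R))| <= e.
Proof.
move=> e0; set L := `|alpha| / (T - t).
have L0 : 0 <= L by rewrite divr_ge0// subr_ge0 ltW.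
(* (1 + h L)^i <= exp (t L) and i h <= t in the bound of euler_error. *)
pose w := e / (t * expR (t * L)).
have w0 : 0 < w by rewrite divr_gt0// mulr_gt0// expR_gt0.
have [de de0 gde] := uniform_continuity_itv lin_drift_continuous w0.
exists (Num.truncn (t / de)) => // n /= n_big i i_n.
have h0 := grid_step_gt0 n; set h := t / n.+1%:R in h0 *.
have hde : h < de.
  rewrite /h ltr_pdivrMr// mulrC -ltr_pdivrMr//.
  by rewrite (lt_le_trans (truncnS_gt _))// ler_nat.
have gw r s : 0 <= r <= t -> 0 <= s <= t -> `|r - s| <= h ->
    `|lin_drift r - lin_drift s| <= w.
  by move=> rt st rs; apply/ltW/gde => //; exact: le_lt_trans hde.
apply: (le_trans (euler_error gw i_n)); rewrite -/h -/L.
have /andP[_ it] := grid_in i_n; rewrite -/h in it.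
have hL1 : 1 <= 1 + h * L by rewrite lerDl mulr_ge0// ltW.
have expb : (1 + h * L) ^+ i <= expR (t * L).
  apply: (@le_trans _ _ (expR (h * L) ^+ i)).
    apply: lerXn2r; rewrite ?nnegrE ?expR_ge0 ?expR_ge1Dx//.
    by apply: addr_ge0 => //; apply: mulr_ge0 => //; exact: ltW.
  rewrite -expRM_natl ler_expR mulrA.
  by rewrite ler_wpM2r.
rewrite (@le_trans _ _ (t * w * expR (t * L)))//.
  apply: ler_pM => //.
  - by apply: mulr_ge0; [apply: mulr_ge0 => //; exact: ltW|exact: ltW].
  - by rewrite exprn_ge0// (le_trans ler01).
  - by rewrite ler_wpM2r// ltW.
rewrite /w le_eqVlt; apply/orP; left; apply/eqP; field.
by rewrite !gt_eqF// expR_gt0.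
Qed.

Lemma euler_step_cvg (s : R) : 0 <= s <= t ->
  (fun n => euler (euler_coef n) sigma (grid_noise n)
     (Num.truncn (s / (t / n.+1%:R)))) @ \oo --> x s.
Proof.
move=> st; have /andP[s0 s_t] := st; apply/cvgrPdist_le => e e0.
have e20 : 0 < e / 2 by rewrite divr_gt0.
have [de de0 xde] := uniform_continuity_itv cx e20.
near=> n; have h0 := grid_step_gt0 n.
have yx : forall i, (i <= n.+1)%N ->
    `|euler (euler_coef n) sigma (grid_noise n) i - x (i%:R * (t / n.+1%:R))| <= e / 2.
  by near: n; exact: euler_cvg.
set h := t / n.+1%:R in h0 yx *.
set i := Num.truncn (s / h).
have /andP[i1 i2] : i%:R <= s / h < i.+1%:R by rewrite truncn_itv// divr_ge0// ltW.
move: i1 i2; rewrite ler_pdivlMr// ltr_pdivrMr// => i1 i2.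
have i_n : (i <= n.+1)%N.
  rewrite -(ler_nat R) -(ler_pM2r h0) (le_trans i1)// (le_trans s_t)//.
  by rewrite /h mulrC divfK// pnatr_eq0.
rewrite (le_trans (ler_distD (x (i%:R * h)) _ _))// (splitr e) lerD//.
  apply/ltW/xde => //; first exact: grid_in.
  rewrite ger0_norm ?subr_ge0//.
  apply: (@lt_trans _ _ h).
    by rewrite ltrBlDr -{1}(mul1r h) -mulrDl nat1r.
  rewrite /h ltr_pdivrMr// mulrC -ltr_pdivrMr//.
  apply: (lt_trans (truncnS_gt _)); rewrite ltr_nat ltnS.
  by near: n; exact: nbhs_infty_gt.
by rewrite distrC; exact: yx.
Unshelve. all: by end_near. Qed.

Lemma euler_bounded : exists M : R, \forall n \near \oo,
  forall i, (i <= n.+1)%N -> `|euler (euler_coef n) sigma (grid_noise n) i| <= M.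
Proof.
have [M M0 xM] := path_bounded; exists (1 + M).
near=> n => i i_n.
rewrite -[X in `|X|](subrK (x (i%:R * (t / n.+1%:R)))).
rewrite (le_trans (ler_normD _ _))// lerD//; last exact/xM/grid_in.
by move: i i_n; near: n; apply: euler_cvg.
Unshelve. all: by end_near. Qed.

(** Each increment is the noise sigma dB plus a drift term of size O(h), and the
    noise is uniformly small because b is uniformly continuous; so the cross terms add
    up to t times a quantity that tends to 0. *)
Lemma quadratic_variation_cvg :
  (fun n => \sum_(i < n.+1) grid_noise n i ^+ 2) @ \oo --> t ->
  (fun n => \sum_(i < n.+1)
    (x (i.+1%:R * (t / n.+1%:R)) - x (i%:R * (t / n.+1%:R))) ^+ 2) @ \oo -->
  sigma ^+ 2 * t.
Proof.
move=> Qt; have [M M0 xM] := path_bounded.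
pose C := (`|alpha| / (T - t)) * M + 1.
have L0 : 0 <= `|alpha| / (T - t) by rewrite divr_ge0// subr_ge0 ltW.
have C0 : 0 < C by rewrite ltr_wpDl// mulr_ge0// ltW.
have driftC r : 0 <= r <= t -> `|lin_drift r| <= C.
  move=> rt; rewrite normrM normrN /C ler_wpDr// ler_pM// ?xM//.
  by apply: rate_bound => //; case/andP: rt.
suff : (fun n => \sum_(i < n.+1)
    (x (i.+1%:R * (t / n.+1%:R)) - x (i%:R * (t / n.+1%:R))) ^+ 2 -
    sigma ^+ 2 * \sum_(i < n.+1) grid_noise n i ^+ 2) @ \oo --> (0 : R).
  move=> D0; rewrite -[sigma ^+ 2 * t]add0r.
  have -> : (fun n => \sum_(i < n.+1)
      (x (i.+1%:R * (t / n.+1%:R)) - x (i%:R * (t / n.+1%:R))) ^+ 2) =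
    (fun n => (\sum_(i < n.+1)
      (x (i.+1%:R * (t / n.+1%:R)) - x (i%:R * (t / n.+1%:R))) ^+ 2 -
      sigma ^+ 2 * \sum_(i < n.+1) grid_noise n i ^+ 2) +
      sigma ^+ 2 * \sum_(i < n.+1) grid_noise n i ^+ 2).
    by apply/funext => n; rewrite subrK.
  apply: cvgD; first exact: D0.
  by apply: cvgM; [exact: cvg_cst|exact: Qt].
apply/cvgrPdist_le => e e0.
pose eta := e / (t * C * (2 * `|sigma| + C)).
have p0 : 0 < t * C * (2 * `|sigma| + C).
  by rewrite !mulr_gt0// ltr_wpDl// mulr_ge0.
have eta0 : 0 < eta by rewrite divr_gt0.
have [de de0 bde] := uniform_continuity_itv cb eta0.
near=> n; have h0 := grid_step_gt0 n; set h := t / n.+1%:R in h0 *.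
have hbig : h < Num.min de eta.
  have m0 : 0 < Num.min de eta by rewrite lt_min de0 eta0.
  rewrite /h ltr_pdivrMr// mulrC -ltr_pdivrMr//.
  apply: (lt_trans (truncnS_gt _)); rewrite ltr_nat ltnS.
  by near: n; exact: nbhs_infty_gt.
move: hbig; rewrite lt_min => /andP[hde heta].
rewrite sub0r normrN mulr_sumr -sumrB.
apply: (le_trans (ler_norm_sum _ _ _)).
apply: (@le_trans _ _ (\sum_(i < n.+1) h * (C * (2 * `|sigma| + C) * eta))).
  apply: ler_sum => -[i /= i_n] _.
  have /andP[u0 ut] := grid_in (ltnW i_n).
  have /andP[v0 vt] := grid_in i_n.
  rewrite -/h in u0 ut v0 vt.
  have vu : i.+1%:R * h - i%:R * h = h by rewrite -mulrBl -natrB// subSnn mul1r.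
  have uv : i%:R * h <= i.+1%:R * h by rewrite -subr_ge0 vu ltW.
  rewrite (solution_increment u0 uv vt) /grid_noise -/h.
  set I := (\int[mu]_(r in _) _).
  have IC : `|I| <= h * C.
    have := @integral_close_to_cst lin_drift _ _ 0 C uv.
    rewrite vu mul0r subr0 [h * C]mulrC; apply; first exact: integrable_lin_drift.
    move=> r /andP[ur rv]; rewrite subr0; apply: driftC.
    by rewrite (le_trans u0 ur) (le_trans rv vt).
  set X := b _ - b _.
  have Xe : `|X| <= eta.
    apply/ltW/bde; rewrite ?u0 ?v0//.
    by rewrite vu gtr0_norm.
  have -> : (I + sigma * X) ^+ 2 - sigma ^+ 2 * X ^+ 2 =
    I * (2 * sigma * X + I) by ring.
  have S2 : `|2 * sigma * X + I| <= (2 * `|sigma| + C) * eta.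
    apply: le_trans (ler_normD _ _) _; rewrite [leRHS]mulrDl; apply: lerD.
      by rewrite !normrM gtr0_norm//; apply: ler_wpM2l => //; exact: mulr_ge0.
    by rewrite (le_trans IC)// mulrC ler_pM2l// ltW.
  rewrite normrM; apply: le_trans (ler_pM _ _ IC S2) _ => //.
  by rewrite !mulrA.
rewrite sumr_const card_ord -[leLHS]mulr_natl [leLHS]mulrA.
have -> : n.+1%:R * h = t by rewrite /h mulrC divfK// pnatr_eq0.
by rewrite [leLHS]mulrA [t * _]mulrA mulrC /eta divfK// gt_eqF.
Unshelve. all: by end_near. Qed.

End pathwise_drift.

(** * A pathwise lower bound for the discrete densities *)

Section density_lower_bound.
Context {R : realType}.
Variables (t sigma M K K1 L V : R).
Hypothesis sigma_gt0 : 0 < sigma.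

(** Obtained by adding up the bounds of [exponent_bound] over a grid of total length
    at most t, when M bounds the scheme, K and K1 the gap between the rates and its
    slope, L the first rate, and V the sum of the squared noises. *)
Definition density_log_bound : R :=
  ((K * M ^+ 2) / 2 + t * (K1 * M ^+ 2 / 2 + K * t * L ^+ 2 * M ^+ 2 + K * L * M ^+ 2)
   + t * (K ^+ 2 * M ^+ 2) / 2) / sigma ^+ 2 + K * V.

Variables (h : R) (A1 A2 : nat -> R) (x : nat -> R) (m : nat).
Hypothesis h_gt0 : 0 < h.
Hypothesis h_le : h <= t.
Hypothesis mh_le : m%:R * h <= t.
Let b1 i := 1 - h * A1 i.
Let b2 i := 1 - h * A2 i.
Let c i := A2 i - A1 i.
Let y := euler b1 sigma x.
Hypothesis y_le : forall i, (i <= m)%N -> `|y i| <= M.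
Hypothesis c_le : forall i, (i <= m)%N -> `|c i| <= K.
Hypothesis A1_le : forall i, (i <= m)%N -> `|A1 i| <= L.
Hypothesis K1_ge0 : 0 <= K1.
Hypothesis dc_le : forall i, (i < m)%N -> `|c i.+1 - c i| <= h * K1.
Hypothesis x_le : \sum_(i < m) x i ^+ 2 <= V.

Let M0 : 0 <= M := le_trans (normr_ge0 _) (y_le (leq0n m)).
Let K0 : 0 <= K := le_trans (normr_ge0 _) (c_le (leq0n m)).
Let L0 : 0 <= L := le_trans (normr_ge0 _) (A1_le (leq0n m)).

Let sqr_le (a b : R) : `|a| <= b -> a ^+ 2 <= b ^+ 2.
Proof.
move=> ab; rewrite -(ger0_norm (sqr_ge0 a)) normrX.
by rewrite lerXn2r ?nnegrE// (le_trans _ ab).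
Qed.

Let q1 := K1 * M ^+ 2 / 2 + K * t * L ^+ 2 * M ^+ 2 + K * L * M ^+ 2.

(** With D the increment of y,
    c y D = (c' y'^2 - c y^2) / 2 - (c' - c) y'^2 / 2 - c D^2 / 2, where primes denote
    the next index, and sigma x differs from D by a term of order h.  The first term
    telescopes, the second is of order h because c is
    Lipschitz, and the last is controlled by the squared noise. *)
Let exponent_bound i : (i < m)%N ->
  c i * y i * (sigma * x i) <=
    (c i.+1 * y i.+1 ^+ 2 - c i * y i ^+ 2) / 2 + h * q1 + K * sigma ^+ 2 * x i ^+ 2.
Proof.
move=> im.
have y2 j : (j <= m)%N -> y j ^+ 2 <= M ^+ 2 by move=> /y_le/sqr_le.
have ydef : y i.+1 = (1 - h * A1 i) * y i + sigma * x i by [].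
set D := y i.+1 - y i.
have -> : c i * y i * (sigma * x i) = (c i.+1 * y i.+1 ^+ 2 - c i * y i ^+ 2) / 2
    + (c i - c i.+1) * y i.+1 ^+ 2 / 2 + (- c i) * D ^+ 2 / 2
    + h * (c i * A1 i * y i ^+ 2).
  by rewrite /D ydef; field.
have B1 : (c i - c i.+1) * y i.+1 ^+ 2 <= (h * K1) * M ^+ 2.
  apply: le_trans (ler_norm _) _; rewrite normrM (ger0_norm (sqr_ge0 _)).
  apply: ler_pM; rewrite ?sqr_ge0//; last exact: (y2 i.+1 im).
  by rewrite distrC dc_le.
have D2 : D ^+ 2 <= 2 * (sigma ^+ 2 * x i ^+ 2) + 2 * (h * t * (L ^+ 2 * M ^+ 2)).
  have -> : D ^+ 2 = 2 * (sigma ^+ 2 * x i ^+ 2) + 2 * (h ^+ 2 * (A1 i ^+ 2 * y i ^+ 2))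
      - (sigma * x i + h * A1 i * y i) ^+ 2 by rewrite /D ydef; ring.
  rewrite -addrA lerD2l lerBlDr (le_trans (_ : _ <= 2 * (h * t * (L ^+ 2 * M ^+ 2))))//;
    last by rewrite lerDl sqr_ge0.
  rewrite ler_pM2l//; apply: ler_pM.
  - exact: sqr_ge0.
  - by rewrite mulr_ge0 ?sqr_ge0.
  - by rewrite expr2 ler_pM2l.
  apply: ler_pM; rewrite ?sqr_ge0 ?y2 ?(ltnW im)//.
  by apply: sqr_le; apply: A1_le; exact: ltnW.
have B2 : (- c i) * D ^+ 2 <=
    K * (2 * (sigma ^+ 2 * x i ^+ 2) + 2 * (h * t * (L ^+ 2 * M ^+ 2))).
  apply: le_trans (ler_norm _) _; rewrite normrM normrN (ger0_norm (sqr_ge0 _)).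
  by apply: ler_pM; rewrite ?sqr_ge0//; apply: c_le; exact: ltnW.
have B3 : c i * A1 i * y i ^+ 2 <= K * L * M ^+ 2.
  apply: le_trans (ler_norm _) _; rewrite normrM (ger0_norm (sqr_ge0 _)) normrM.
  apply: ler_pM; [exact: mulr_ge0|exact: sqr_ge0| |exact: (y2 i (ltnW im))].
  by apply: ler_pM => //; [apply: c_le|apply: A1_le]; exact: ltnW.
have B3' : h * (c i * A1 i * y i ^+ 2) <= h * (K * L * M ^+ 2) by rewrite ler_pM2l.
rewrite /q1; lra.
Qed.

Lemma drift_density_lower_bound :
  expR (- density_log_bound) <= drift_density h sigma b1 b2 m x.
Proof.
rewrite /drift_density /shift_density.
rewrite -(big_morph expR (@expRD R) (@expR0 R)) ler_expR.
have s2 : 0 < sigma ^+ 2 by rewrite exprn_gt0.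
pose F i := c i * y i ^+ 2 / 2 / sigma ^+ 2.
have term i : (i < m)%N ->
    - (F i.+1 - F i + h * (q1 / sigma ^+ 2) + K * x i ^+ 2 +
       h * ((K ^+ 2 * M ^+ 2) / 2 / sigma ^+ 2)) <=
    - (drift_gap sigma b1 b2 x i * x i / h) - drift_gap sigma b1 b2 x i ^+ 2 / (2 * h).
  move=> im.
  have -> : - (drift_gap sigma b1 b2 x i * x i / h) -
      drift_gap sigma b1 b2 x i ^+ 2 / (2 * h)
      = - (c i * y i * (sigma * x i) + h * ((c i) ^+ 2 * y i ^+ 2) / 2) / sigma ^+ 2.
    rewrite /drift_gap -/y /b1 /b2 /c; field.
    by rewrite !gt_eqF.
  rewrite mulNr lerN2 ler_pdivrMr//.
  have -> : (F i.+1 - F i + h * (q1 / sigma ^+ 2) + K * x i ^+ 2 +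
       h * ((K ^+ 2 * M ^+ 2) / 2 / sigma ^+ 2)) * sigma ^+ 2 =
      (c i.+1 * y i.+1 ^+ 2 - c i * y i ^+ 2) / 2 + h * q1 + K * sigma ^+ 2 * x i ^+ 2
      + h * (K ^+ 2 * M ^+ 2) / 2.
    by rewrite /F; field; rewrite gt_eqF.
  apply: lerD; first exact: exponent_bound.
  rewrite ler_pM2r// ler_pM2l//; apply: ler_pM; rewrite ?sqr_ge0//.
    by apply: sqr_le; apply: c_le; exact: ltnW.
  by apply: sqr_le; apply: y_le; exact: ltnW.
apply: (@le_trans _ _ (\sum_(i < m) - (F i.+1 - F i + h * (q1 / sigma ^+ 2) +
    K * x i ^+ 2 + h * ((K ^+ 2 * M ^+ 2) / 2 / sigma ^+ 2)))); last first.
  by apply: ler_sum => i _; exact: term.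
have sum_cst (k : R) : \sum_(i < m) k = m%:R * k.
  by rewrite sumr_const card_ord mulr_natl.
rewrite sumrN lerN2 !big_split/= !sum_cst -mulr_sumr.
have -> : \sum_(i < m) F i.+1 + \sum_(i < m) - F i = F m - F 0%N.
  by rewrite -big_split/= -(big_mkord xpredT (fun i => F i.+1 - F i)) telescope_sumr.
have F0 : F 0%N = 0 by rewrite /F /y/= expr0n/= mulr0 !mul0r.
have Fm : F m <= (K * M ^+ 2) / 2 / sigma ^+ 2.
  rewrite /F ler_pM2r ?invr_gt0// ler_pM2r ?invr_gt0//.
  apply: le_trans (ler_norm _) _; rewrite normrM (ger0_norm (sqr_ge0 _)).
  by apply: ler_pM; rewrite ?sqr_ge0 ?c_le//; apply: sqr_le; exact: y_le.
have t0 : 0 <= t := le_trans (ltW h_gt0) h_le.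
have M20 := sqr_ge0 M; have L20 := sqr_ge0 L; have s20 := sqr_ge0 sigma.
have q10 : m%:R * (h * (q1 / sigma ^+ 2)) <= t * (q1 / sigma ^+ 2).
  rewrite mulrA; apply: ler_wpM2r => //; apply: divr_ge0; last exact: ltW.
  apply: addr_ge0; [apply: addr_ge0|].
  - by apply: divr_ge0 => //; apply: mulr_ge0.
  - by apply: mulr_ge0 => //; apply: mulr_ge0 => //; apply: mulr_ge0.
  - by apply: mulr_ge0 => //; apply: mulr_ge0.
have q20 : m%:R * (h * ((K ^+ 2 * M ^+ 2) / 2 / sigma ^+ 2)) <=
    t * ((K ^+ 2 * M ^+ 2) / 2 / sigma ^+ 2).
  rewrite mulrA; apply: ler_wpM2r => //; apply: divr_ge0 => //.
  by apply: divr_ge0 => //; apply: mulr_ge0 => //; exact: sqr_ge0.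
have xV : K * \sum_(i < m) x i ^+ 2 <= K * V by rewrite ler_wpM2l.
rewrite F0 subr0 /density_log_bound -/q1.
have -> : (K * M ^+ 2 / 2 + t * q1 + t * (K ^+ 2 * M ^+ 2) / 2) / sigma ^+ 2 =
  K * M ^+ 2 / 2 / sigma ^+ 2 + t * (q1 / sigma ^+ 2) +
  t * (K ^+ 2 * M ^+ 2 / 2 / sigma ^+ 2) by field; rewrite gt_eqF.
lra.
Qed.

End density_lower_bound.

(** * Quadratic sums of Gaussian noises *)

Section gaussian_quadratic_sums.
Context d (Omega : measurableType d) (R : realType) (P : probability Omega R).

(** The exponential moment with parameter c of one standard Gaussian square,
    recentred at 1 + de; c has the sign of de and is small enough for the rate to be
    less than 1. *)
Definition chernoff_rate (de : R) : R :=
  let c := de / (4 * (1 + `|de|)) in expR (- c * (1 + de)) / Num.sqrt (1 - 2 * c).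

Lemma chernoff_param (de : R) : -1 < de -> de != 0 ->
  let c := de / (4 * (1 + `|de|)) in
  c < 1 / 2 /\ 1 < (1 - 2 * c) * (1 + 2 * c * (1 + de)).
Proof.
move=> de1 de0 c.
have n0 : 0 < `|de| by rewrite normr_gt0.
have p0 : 0 < 4 * (1 + `|de|) by lra.
have cE : c * (4 * (1 + `|de|)) = de by rewrite /c divfK// gt_eqF.
split; first by rewrite /c ltr_pdivrMr//; have := ler_norm de; lra.
rewrite -subr_gt0.
have -> : (1 - 2 * c) * (1 + 2 * c * (1 + de)) - 1 =
    2 * c * (de - 2 * c * (1 + de)) by ring.
rewrite -{1}cE.
have -> : 2 * c * (c * (4 * (1 + `|de|)) - 2 * c * (1 + de)) =
    4 * c ^+ 2 * (2 * (1 + `|de|) - (1 + de)) by ring.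
rewrite mulr_gt0//; last by have := ler_norm de; lra.
rewrite mulr_gt0// exprn_even_gt0//=; apply: contra_neq de0 => c0.
by rewrite -cE c0 mul0r.
Qed.

Lemma chernoff_rate_itv (de : R) : -1 < de -> de != 0 -> 0 < chernoff_rate de < 1.
Proof.
move=> de1 de0; have [c2 cgt] := chernoff_param de1 de0.
rewrite /chernoff_rate; set c := de / _ in c2 cgt *.
have c0 : 0 < 1 - 2 * c by lra.
have s0 : 0 < Num.sqrt (1 - 2 * c) by rewrite sqrtr_gt0.
rewrite divr_gt0 ?expR_gt0//= ltr_pdivrMr// mul1r mulNr.
rewrite -(@ltr_pXn2r _ 2)// ?nnegrE ?expR_ge0 ?ltW// sqr_sqrtr ?ltW//.
rewrite -expRM_natl mulrN expRN -[ltRHS]invrK ltf_pV2 ?posrE ?expR_gt0 ?invr_gt0//.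
rewrite (lt_le_trans _ (expR_ge1Dx _))//.
by rewrite -[ltLHS]mul1r ltr_pdivrMr// mulrC [X in _ * (1 + X)]mulrA.
Qed.

Section deviation.
Variables (N : probability R R) (xi : nat -> {RV P >-> R}) (h : R).
Hypothesis xi_law : forall i A, measurable A -> P (xi i @^-1` A) = N A.
Hypothesis xi_indep : forall n (A : nat -> set R), (forall i, measurable (A i)) ->
  P (\bigcap_(i < n) xi i @^-1` A i) =
  \big[mule/1%E]_(i < n) P (xi i @^-1` A i).
Hypothesis N_exp_square : forall c : R, c < 1 / 2 ->
  (\int[N]_x (expR (c * x ^+ 2 / h))%:E = ((Num.sqrt (1 - 2 * c))^-1)%:E)%E.

(** Upper deviations for de > 0 and lower deviations for de < 0. *)
Definition deviation (de : R) (m : nat) : set Omega :=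
  [set w | 0 <= de * ((\sum_(i < m) xi i w ^+ 2) / h - m%:R * (1 + de))].

Lemma measurable_deviation de m : measurable (deviation de m).
Proof.
rewrite (_ : deviation de m = (fun w => de * ((\sum_(i < m) xi i w ^+ 2) / h -
    m%:R * (1 + de))) @^-1` `[0, +oo[%classic); last first.
  by apply/seteqP; split => w; rewrite /deviation/= in_itv/= andbT.
rewrite -[_ @^-1` _]setTI; apply: (_ : measurable_fun setT _) => //.
apply: measurable_funM => //; apply: measurable_funB => //.
apply: measurable_funM => //; apply: measurable_sum => i.
exact: measurable_funX.
Qed.

(** Chernoff's bound: Markov's inequality for the exponential of c times the
    deviation, whose expectation factorizes. *)
Lemma deviation_le de m : -1 < de -> de != 0 ->
  (P (deviation de m) <= (chernoff_rate de ^+ m)%:E)%E.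
Proof.
move=> de1 de0; have [c2 _] := chernoff_param de1 de0.
rewrite /chernoff_rate; set c := de / _ in c2 *.
pose g (x : R) := expR (- c * (1 + de)) * expR (c * x ^+ 2 / h).
have mg : measurable_fun setT g.
  apply: measurable_funM => //; apply: measurableT_comp => //.
  by apply: measurable_funM => //; apply: measurable_funM.
rewrite -(@integral_prod_noise _ _ _ P N xi xi_law xi_indep g)//; last 2 first.
- by move=> x; rewrite mulr_ge0 ?expR_ge0.
- rewrite /g; under eq_integral do rewrite EFinM.
  rewrite ge0_integralZl_EFin ?expR_ge0//.
  + by rewrite N_exp_square// -EFinM.
  + apply/measurable_EFinP; apply: measurableT_comp => //.
    by apply: measurable_funM => //; apply: measurable_funM.
rewrite -[X in P X]setIT -integral_indic//; last exact: measurable_deviation.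
apply: ge0_le_integral => //.
- apply/measurable_EFinP; apply: measurable_indic; exact: measurable_deviation.
- apply/measurable_EFinP; apply: measurable_prod => i _.
  exact: (measurableT_comp mg).
move=> w _; rewrite lee_fin indicE.
have [/set_mem wd|_] := boolP (_ \in _); last first.
  by apply: prodr_ge0 => i _; rewrite mulr_ge0 ?expR_ge0.
rewrite /g/= big_split/= -!(big_morph expR (@expRD R) (@expR0 R)) -expRD.
rewrite -[leLHS]expR0 ler_expR sumr_const card_ord -mulr_suml -mulr_sumr.
have n0 : 0 < `|de| by rewrite normr_gt0.
have p0 : 0 < (4 * (1 + `|de|))^-1 by rewrite invr_gt0; lra.
rewrite (_ : _ + _ = (4 * (1 + `|de|))^-1 *
   (de * ((\sum_(i < m) xi i w ^+ 2) / h - m%:R * (1 + de)))).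
  by rewrite mulr_ge0// ltW.
rewrite -[_ *+ m]mulr_natl /c; set p := (4 * _)^-1; set S := \sum_(i < m) _; ring.
Qed.

End deviation.

Variables (N : nat -> probability R R) (xi : nat -> nat -> {RV P >-> R}) (t : R).
Hypothesis t_gt0 : 0 < t.
Hypothesis xi_law : forall n i A, measurable A -> P (xi n i @^-1` A) = N n A.
Hypothesis xi_indep : forall n m (A : nat -> set R), (forall i, measurable (A i)) ->
  P (\bigcap_(i < m) xi n i @^-1` A i) =
  \big[mule/1%E]_(i < m) P (xi n i @^-1` A i).
Hypothesis N_exp_square : forall n (c : R), c < 1 / 2 ->
  (\int[N n]_x (expR (c * x ^+ 2 / (t / n.+1%:R)))%:E =
    ((Num.sqrt (1 - 2 * c))^-1)%:E)%E.

(** The bounds of [deviation_le] are summable in n; apply the Borel-Cantelli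
    lemma. *)
Lemma deviation_ae (de : R) : -1 < de -> de != 0 ->
  {ae P, forall w, \forall n \near \oo,
    de * (\sum_(i < n.+1) xi n i w ^+ 2 - t * (1 + de)) < 0}.
Proof.
move=> de1 de0; have /andP[r0 r1] := chernoff_rate_itv de1 de0.
pose F n := deviation (xi n) (t / n.+1%:R) de n.+1.
have mF n : measurable (F n) by exact: measurable_deviation.
have PF : P (lim_sup_set F) = 0%E.
  apply: lim_sup_set_cvg0 => //.
  apply: (@le_lt_trans _ _ (chernoff_rate de * (1 - chernoff_rate de)^-1)%:E);
    last exact: ltry.
  apply: lime_le; first exact: is_cvg_nneseries.
  apply: nearW => n.
  apply: (@le_trans _ _ (\sum_(0 <= i < n) (chernoff_rate de ^+ i.+1)%:E)%E).
    apply: lee_sum => i _; apply: (@deviation_le (N i) (xi i)) => //.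
    - exact: xi_law.
    - exact: xi_indep.
    - exact: N_exp_square.
  rewrite sumEFin lee_fin.
  have := @geometric_le_lim R n (chernoff_rate de) _ (ltW r0) r0.
  rewrite ger0_norm ?(ltW r0)// => /(_ r1); congr (_ <= _).
  by apply: eq_bigr => i _; rewrite /= exprS.
exists (lim_sup_set F); split => //.
  apply: bigcapT_measurable => n; exact: bigcup_measurable.
move=> w /= nw n _; apply: contrapT => Fw; apply: nw.
exists n => // k /= nk; rewrite ltNge; apply/negP => kw; apply: Fw.
exists k => //=; rewrite /F /deviation/=.
have k0 : (k.+1%:R : R) != 0 by rewrite pnatr_eq0.
have -> : (\sum_(i < k.+1) xi k i w ^+ 2) / (t / k.+1%:R) - k.+1%:R * (1 + de) =
    (k.+1%:R / t) * (\sum_(i < k.+1) xi k i w ^+ 2 - t * (1 + de)).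
  by field; rewrite gt_eqF// nat1r k0.
by rewrite mulrCA mulr_ge0// divr_ge0// ltW.
Qed.

Lemma quadratic_sum_ae :
  {ae P, forall w, (fun n => \sum_(i < n.+1) xi n i w ^+ 2) @ \oo --> t}.
Proof.
have dk k : 0 < (k.+2%:R : R)^-1 < 1.
  by rewrite invr_gt0 ltr0n/= invf_lt1// ltr1n.
have up : {ae P, forall w, forall k, \forall n \near \oo,
    k.+2%:R^-1 * (\sum_(i < n.+1) xi n i w ^+ 2 - t * (1 + k.+2%:R^-1)) < 0}.
  apply: ae_foralln => k; have /andP[k0 k1] := dk k.
  by apply: deviation_ae; [rewrite (lt_trans (ltrN10 _))|rewrite gt_eqF].
have lo : {ae P, forall w, forall k, \forall n \near \oo,
    - k.+2%:R^-1 * (\sum_(i < n.+1) xi n i w ^+ 2 - t * (1 - k.+2%:R^-1)) < 0}.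
  apply: ae_foralln => k; have /andP[k0 k1] := dk k.
  by apply: deviation_ae; [rewrite ltrN2|rewrite oppr_eq0 gt_eqF].
apply: filterS2 up lo => w up lo; apply/cvgrPdist_lt => e e0.
have [k ke] : exists k : nat, t * k.+2%:R^-1 < e.
  exists (Num.truncn (t / e)); rewrite ltr_pdivrMr// mulrC -ltr_pdivrMr//.
  by rewrite (lt_trans (truncnS_gt _))// ltr_nat.
have /andP[k0 k1] := dk k.
near=> n.
have un : k.+2%:R^-1 * (\sum_(i < n.+1) xi n i w ^+ 2 - t * (1 + k.+2%:R^-1)) < 0.
  by near: n; exact: up.
have ln : - k.+2%:R^-1 * (\sum_(i < n.+1) xi n i w ^+ 2 - t * (1 - k.+2%:R^-1)) < 0.
  by near: n; exact: lo.
move: un ln; rewrite pmulr_rlt0// nmulr_rlt0 ?oppr_lt0//.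
set S := \sum_(i < _) _; set q := k.+2%:R^-1 in ke *.
by move=> un ln; rewrite ltr_norml; apply/andP; split; lra.
Unshelve. all: by end_near. Qed.

End gaussian_quadratic_sums.

(** The constants of [drift_density_lower_bound] can be chosen independently of n:
    the Euler schemes are eventually bounded, so are the sums of squared noises, and
    s |-> a / (T - s) is bounded and Lipschitz on [0, t] because t < T. *)
Lemma drift_density_eventually_ge (R : realType) (T t a1 a2 sigma : R) (x b : R -> R) :
  0 < t -> t < T -> 0 < sigma ->
  {within `[0, t], continuous x} -> x 0 = 0 ->
  (forall s, 0 <= s <= t -> x s =
    \int[lebesgue_measure]_(r in `[0, s]) lin_drift T a1 x r + sigma * (b s - b 0)) ->
  (fun n => \sum_(i < n.+1) grid_noise t b n i ^+ 2) @ \oo --> t ->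
  exists2 k : R, 0 < k & \forall n \near \oo,
    k <= drift_density (t / n.+1%:R) sigma (euler_coef T t a1 n)
           (euler_coef T t a2 n) n.+1 (grid_noise t b n).
Proof.
move=> t0 tT s0 cx x0 sde Qt.
have [M yM] := euler_bounded t0 tT cx x0 sde.
have Tt : 0 < T - t by rewrite subr_gt0.
pose K := `|a2 - a1| / (T - t); pose L := `|a1| / (T - t).
pose K1 := `|a2 - a1| / (T - t) ^+ 2.
exists (expR (- density_log_bound t sigma M K K1 L (t + 1))); first exact: expR_gt0.
near=> n.
have yMn : forall i, (i <= n.+1)%N ->
    `|euler (euler_coef T t a1 n) sigma (grid_noise t b n) i| <= M.
  by near: n.
have Qn : \sum_(i < n.+1) grid_noise t b n i ^+ 2 <= t + 1.
  have : `|t - \sum_(i < n.+1) grid_noise t b n i ^+ 2| < 1.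
    by near: n; move/cvgrPdist_lt : Qt; apply.
  by rewrite ltr_norml; lra.
have h0 := grid_step_gt0 t0 n; set h := t / n.+1%:R in h0 *.
have gin i : (i <= n.+1)%N -> i%:R * h <= t by move=> /(grid_in t0)/andP[].
have cE i : a2 / (T - i%:R * h) - a1 / (T - i%:R * h) = (a2 - a1) / (T - i%:R * h).
  by rewrite mulrBl.
apply: (@drift_density_lower_bound R t sigma M K K1 L (t + 1) s0 h
  (fun i => a1 / (T - i%:R * h)) (fun i => a2 / (T - i%:R * h))) => //.
- by have := gin 1%N (ltn0Sn _); rewrite mul1r.
- exact: gin.
- by move=> i i_n; rewrite /= cE; apply: rate_bound => //; exact: gin.
- by move=> i i_n; apply: rate_bound => //; exact: gin.
- by rewrite divr_ge0// sqr_ge0.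
move=> i i_n; rewrite /= !cE.
have u0 : 0 < T - i.+1%:R * h by rewrite (lt_le_trans Tt)// lerD2l lerN2 gin.
have v0 : 0 < T - i%:R * h by rewrite (lt_le_trans Tt)// lerD2l lerN2 gin// ltnW.
have -> : (a2 - a1) / (T - i.+1%:R * h) - (a2 - a1) / (T - i%:R * h) =
    h * ((a2 - a1) / (T - i.+1%:R * h) / (T - i%:R * h)).
  move: u0 v0; rewrite -natr1 => u0 v0.
  by field; rewrite !gt_eqF.
rewrite normrM (gtr0_norm h0) ler_pM2l// normrM normfV (gtr0_norm v0).
rewrite /K1 expr2 invfM [leRHS]mulrA; apply: ler_pM => //.
- by rewrite invr_ge0 ltW.
- by apply: rate_bound => //; exact: gin.
by rewrite lef_pV2 ?posrE// lerD2l lerN2 gin// ltnW.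
Unshelve. all: by end_near. Qed.

Section test_functionals.
Context {R : realType} {I : Type}.

Inductive test_functional : ((I -> R) -> R) -> Prop :=
| test_one : test_functional (cst 1)
| test_coord (s : I) (phi : R -> R) : continuous phi -> (forall r, 0 <= phi r <= 1) ->
    test_functional (fun y => phi (y s))
| test_compl f : test_functional f -> test_functional (fun y => 1 - f y)
| test_mul f g : test_functional f -> test_functional g ->
    test_functional (fun y => f y * g y).

Lemma test_functional_itv01 f : test_functional f -> forall y, 0 <= f y <= 1.
Proof.
elim=> {f} [|s phi _ phi01|f _ f01|f g _ f01 _ g01] y //=.
- by rewrite ler01 lexx.
- by have := f01 y; lra.
- have /andP[f0 f1] := f01 y; have /andP[g0 g1] := g01 y.
  by rewrite mulr_ge0//= mulr_ile1.
Qed.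

Lemma test_functional_cvg f (y_ : nat -> I -> R) (y : I -> R) :
  test_functional f -> (forall s, y_ ^~ s @ \oo --> y s) ->
  (fun n => f (y_ n)) @ \oo --> f y.
Proof.
move=> tf yy; elim: tf => {f} [|s phi cphi _|f _ fy|f g _ fy _ gy].
- exact: cvg_cst.
- by apply: continuous_cvg; [exact: cphi|exact: yy].
- by apply: cvgB; [exact: cvg_cst|exact: fy].
- exact: cvgM.
Qed.

Lemma measurable_test_functional d (X : measurableType d) (Y : X -> I -> R) f :
  (forall s, measurable_fun setT (fun w => Y w s)) -> test_functional f ->
  measurable_fun setT (fun w => f (Y w)).
Proof.
move=> mY; elim=> {f} [|s phi cphi _|f _ mf|f g _ mf _ mg].
- exact: measurable_cst.
- apply: (measurableT_comp _ (mY s)); exact: continuous_measurable_fun.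
- exact: measurable_funB.
- exact: measurable_funM.
Qed.

(** The indicator of [a, b] is the limit of r |-> max 0 (1 - n dist(r, [a, b])). *)
Lemma test_coord_itv (a b : R) (s : I) : exists2 f_ : nat -> (I -> R) -> R,
  (forall n, test_functional (f_ n)) &
  forall y, f_ ^~ y @ \oo --> (\1_[set y | a <= y s <= b] y : R).
Proof.
pose dist (r : R) := Num.max 0 (Num.max (a - r) (r - b)).
pose phi (n : nat) (r : R) := Num.max 0 (1 - n%:R * dist r).
have cmax (f g : R -> R) : continuous f -> continuous g ->
    continuous (fun r => Num.max (f r) (g r)).
  by move=> cf cg r; apply: continuous_max; [exact: cf|exact: cg].
have cdist : continuous dist.
  apply: (cmax (cst 0)); first exact: cst_continuous.
  apply: (cmax (fun r => a - r) (fun r => r - b)) => r.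
    by apply: cvgB; [exact: cvg_cst|exact: cvg_id].
  by apply: cvgB; [exact: cvg_id|exact: cvg_cst].
have dist0 r : 0 <= dist r by rewrite le_max lexx.
exists (fun n y => phi n (y s)).
  move=> n; apply: (@test_coord s (phi n)).
    apply: (cmax (cst 0)) => [|r]; first exact: cst_continuous.
    apply: cvgB; first exact: cvg_cst.
    by apply: cvgM; [exact: cvg_cst|exact: cdist].
  by move=> r; rewrite le_max lexx/= ge_max ler01/= gerBl mulr_ge0.
move=> y; have [yab|yab] := boolP (a <= y s <= b).
  rewrite indicE mem_set//; apply: cvg_near_cst; apply: nearW => n.
  have /andP[ya yb] := yab.
  have -> : phi n (y s) = 1; last by [].
  rewrite /phi (_ : dist _ = 0) ?mulr0 ?subr0 ?max_r//.
  by rewrite /dist max_l// ge_max !subr_le0 ya.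
rewrite indicE memNset//=; last exact/negP.
have d0 : 0 < dist (y s).
  rewrite lt_max ltxx/= lt_max !subr_gt0.
  by move: yab; rewrite negb_and -!ltNge.
apply: cvg_near_cst; exists (Num.truncn (dist (y s))^-1).+1 => // n /= nd.
rewrite /phi max_l// subr_le0 -ler_pdivrMr// mul1r.
by rewrite ltW// (lt_le_trans (truncnS_gt _))// ler_nat.
Qed.

End test_functionals.

(** * Increments of the Wiener process on a grid *)

Section wiener_grid.
Context d (Omega : measurableType d) (R : realType) (P : probability Omega R).
Variables (B : R -> {RV P >-> R}) (t : R).
Hypothesis hB : wiener_process B.
Hypothesis t_gt0 : 0 < t.

Definition wiener_noise (n i : nat) : {RV P >-> R} :=
  (B (i.+1%:R * (t / n.+1%:R)) \- B (i%:R * (t / n.+1%:R)))%R.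

Lemma wiener_noise_law n i (A : set R) : measurable A ->
  P (wiener_noise n i @^-1` A) = normal_prob 0 (Num.sqrt (t / n.+1%:R)) A.
Proof.
move=> mA; have h0 := grid_step_gt0 t_gt0 n.
have u0 : 0 <= i%:R * (t / n.+1%:R) by rewrite mulr_ge0// ltW.
have uv : i%:R * (t / n.+1%:R) < i.+1%:R * (t / n.+1%:R).
  by rewrite ltr_pM2r// ltr_nat.
have -> : t / n.+1%:R = i.+1%:R * (t / n.+1%:R) - i%:R * (t / n.+1%:R).
  by rewrite -mulrBl -natrB// subSnn mul1r.
exact: (wiener_normal_increments hB u0 uv mA).
Qed.

Lemma wiener_noise_indep n m (A : nat -> set R) : (forall i, measurable (A i)) ->
  P (\bigcap_(i < m) wiener_noise n i @^-1` A i) =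
  \big[mule/1%E]_(i < m) P (wiener_noise n i @^-1` A i).
Proof.
move=> mA; have h0 := grid_step_gt0 t_gt0 n.
apply: (wiener_indep_increments hB (t := fun i => i%:R * (t / n.+1%:R))) => //.
- by rewrite mul0r.
- by move=> i _; rewrite ler_pM2r// ler_nat.
Qed.

Definition wiener_noise_prob (n : nat) : probability R R :=
  distribution P (wiener_noise n 0).

(** The two laws live on two presentations of the Borel sets of the real line, which
    the identity map transports onto each other. *)
Lemma ge0_integral_wiener_noise_prob n (f : R -> \bar R) :
  measurable_fun setT f -> (forall x, 0 <= f x)%E ->
  (\int[wiener_noise_prob n]_x f x =
   \int[normal_prob 0 (Num.sqrt (t / n.+1%:R))]_x f x)%E.
Proof.
move=> mf f0.
pose idR : R -> measurableTypeR R := fun x => x.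
have mid : measurable_fun setT idR by move=> _ A mA; rewrite setTI; exact: mA.
pose N : probability R R := wiener_noise_prob n.
transitivity (\int[pushforward N idR]_x f x)%E.
  by rewrite [RHS]ge0_integral_pushforward.
apply: (@eq_measure_integral _ (measurableTypeR R) R setT
  (normal_prob 0 (Num.sqrt (t / n.+1%:R)))) => A mA _.
exact: wiener_noise_law.
Qed.

Let step_gt0 n : 0 < Num.sqrt (t / n.+1%:R).
Proof. by rewrite sqrtr_gt0 grid_step_gt0. Qed.

Let step_sqr n : Num.sqrt (t / n.+1%:R) ^+ 2 = t / n.+1%:R.
Proof. by rewrite sqr_sqrtr// ltW// grid_step_gt0. Qed.

Lemma wiener_noise_distribution n i (A : set R) : measurable A ->
  P (wiener_noise n i @^-1` A) = wiener_noise_prob n A.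
Proof. by move=> mA; rewrite wiener_noise_law// -(wiener_noise_law n 0). Qed.

Lemma wiener_noise_shift n (u : R) (k : R -> \bar R) :
  measurable_fun setT k -> (forall x, 0 <= k x)%E ->
  (\int[wiener_noise_prob n]_x
     ((shift_density (t / n.+1%:R) u x)%:E * k (x + u)%R) =
   \int[wiener_noise_prob n]_x k x)%E.
Proof.
move=> mk k0; rewrite !ge0_integral_wiener_noise_prob//; last 2 first.
- apply: emeasurable_funM.
    apply/measurable_EFinP; apply: measurableT_comp => //.
    apply: measurable_funB => //; apply: measurable_funN.
    by apply: measurable_funM => //; apply: measurable_funM.
  by apply: (measurableT_comp mk); exact: measurable_funD.
- by move=> x; apply: mule_ge0 => //; rewrite lee_fin expR_ge0.
rewrite -(gaussian_shift u (step_gt0 n) mk k0).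
by apply: eq_integral => x _; rewrite /shift_density step_sqr.
Qed.

Lemma wiener_noise_exp_square n (c : R) : c < 1 / 2 ->
  (\int[wiener_noise_prob n]_x (expR (c * x ^+ 2 / (t / n.+1%:R)))%:E =
    ((Num.sqrt (1 - 2 * c))^-1)%:E)%E.
Proof.
move=> c2; rewrite ge0_integral_wiener_noise_prob//; last first.
  apply/measurable_EFinP; apply: measurableT_comp => //.
  by apply: measurable_funM => //; apply: measurable_funM.
rewrite -(gaussian_exp_square (step_gt0 n) c2).
by apply: eq_integral => x _; rewrite step_sqr.
Qed.

Lemma wiener_quadratic_variation_ae : {ae P, forall w,
  (fun n => \sum_(i < n.+1) grid_noise t (B ^~ w) n i ^+ 2) @ \oo --> t}.
Proof.
exact: (quadratic_sum_ae t_gt0 wiener_noise_distribution wiener_noise_indep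
  wiener_noise_exp_square).
Qed.

Section solution.
Variables (T alpha sigma : R) (X : R -> {RV P >-> R}).
Hypothesis tT : t < T.
Hypothesis hX : strong_solution B T alpha sigma X.

Lemma solution_pathwise_ae : {ae P, forall w,
  [/\ {within `[0, t], continuous (X ^~ w)}, X 0 w = 0,
      {within `[0, t], continuous (B ^~ w)} &
      forall s, 0 <= s <= t -> X s w =
        \int[lebesgue_measure]_(r in `[0, s]) lin_drift T alpha (X ^~ w) r +
        sigma * (B s w - B 0 w)]}.
Proof.
apply: filterS3 (solution_start hX) (solution_sde hX) (wiener_continuous hB).
move=> w X0 sde cB; split => //.
- have cX : {within `[0, T[, continuous (X ^~ w)} by exact: solution_continuous hX _.
  apply: continuous_subspaceW cX => r /=.
  by rewrite !in_itv/= => /andP[-> /=] /le_lt_trans; apply.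
- apply: continuous_subspaceW cB => r /=.
  by rewrite !in_itv/= => /andP[->].
move=> s /andP[s0 st]; rewrite sde ?X0 ?add0r//.
by rewrite s0 (le_lt_trans st).
Qed.

Definition euler_path (n : nat) (w : Omega) (s : set_type `[0, t]) : R :=
  euler (euler_coef T t alpha n) sigma (grid_noise t (B ^~ w) n)
    (Num.truncn (set_val s / (t / n.+1%:R))).

Lemma measurable_euler_path n s : measurable_fun setT (euler_path n ^~ s).
Proof.
apply: (measurableT_comp (measurable_euler (euler_coef T t alpha n) sigma _)).
apply: measurable_to_real_seq => i.
exact: measurable_funPT (wiener_noise n i).
Qed.

(** Dominated convergence: almost surely the Euler path converges to the solution at
    every time, and test functionals are continuous for pointwise convergence. *)
Lemma test_expectation_cvg (f : (set_type `[0, t] -> R) -> R) :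
  test_functional f ->
  (fun n => \int[P]_w (f (euler_path n w))%:E)%E @ \oo -->
  (\int[P]_w (f (fun s => X (set_val s) w))%:E)%E.
Proof.
move=> tf.
have f01 := test_functional_itv01 tf.
have := @dominated_convergence _ _ _ P _ measurableT
  (fun n w => (f (euler_path n w))%:E)
  (fun w => (f (fun s => X (set_val s) w))%:E) (cst 1%E).
case=> //.
- move=> n; apply/measurable_EFinP.
  exact: (measurable_test_functional (measurable_euler_path n) tf).
- apply/measurable_EFinP.
  by apply: (measurable_test_functional (Y := fun w s => X (set_val s) w)) tf => s.
- apply: filterS solution_pathwise_ae => w [cX X0 _ sde] _.
  apply: cvg_EFin; first exact: nearW.
  apply: (test_functional_cvg tf) => s.
  apply: (euler_step_cvg t_gt0 tT cX X0 sde).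
  by have := set_valP s; rewrite /= in_itv.
- exact: finite_measure_integrable_cst.
- apply: aeW => w n _ /=; have /andP[f0 f1] := f01 (euler_path n w).
  by rewrite lee_fin ger0_norm.
Qed.

End solution.

End wiener_grid.

(** * Domination on test functionals *)

Section test_domination.
Context d (Omega : measurableType d) (R : realType) (P : probability Omega R).
Variables (B : R -> {RV P >-> R}) (T t a1 a2 sigma : R).
Variables X1 X2 : R -> {RV P >-> R}.
Hypothesis hB : wiener_process B.
Hypothesis t_gt0 : 0 < t.
Hypothesis tT : t < T.
Hypothesis sigma_gt0 : 0 < sigma.
Hypothesis hX1 : strong_solution B T a1 sigma X1.
Hypothesis hX2 : strong_solution B T a2 sigma X2.

Let density (n : nat) (w : Omega) : R :=
  drift_density (t / n.+1%:R) sigma (euler_coef T t a1 n) (euler_coef T t a2 n)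
    n.+1 (grid_noise t (B ^~ w) n).

Let measurable_density n : measurable_fun setT (density n).
Proof.
apply: (measurableT_comp (measurable_drift_density _ _ _ _ _)).
apply: measurable_to_real_seq => i.
exact: measurable_funPT (wiener_noise B t n i).
Qed.

Lemma euler_path_change_of_drift n f : test_functional f ->
  (\int[P]_w ((density n w)%:E * (f (euler_path B T a1 sigma n w))%:E) =
   \int[P]_w (f (euler_path (t := t) B T a2 sigma n w))%:E)%E.
Proof.
move=> tf; have h0 := grid_step_gt0 t_gt0 n.
pose idx (s : set_type `[0, t]) := Num.truncn (set_val s / (t / n.+1%:R)).
have idx_le s : (idx s <= n.+1)%N.
  have /andP[s0 st] : 0 <= set_val s <= t by have := set_valP s; rewrite /= in_itv.
  rewrite -ltnS truncn_lt_nat; last by rewrite divr_ge0// ltW.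
  rewrite ltr_pdivrMr// (le_lt_trans st)// mulrCA ltr_pMr//.
  by rewrite ltr_pdivlMr// mul1r ltr_nat.
pose F (y : real_seq R) : \bar R := (f (fun s => y (idx s)))%:E.
have mF : measurable_fun setT F.
  apply/measurable_EFinP.
  have mY r : measurable_fun setT (fun y : real_seq R => y (idx r)).
    exact: measurable_real_seq_coord.
  exact: (measurable_test_functional mY tf).
have F0 y : (0 <= F y)%E.
  by rewrite lee_fin; have /andP[] := test_functional_itv01 tf (fun s => y (idx s)).
have := change_of_drift (wiener_noise_distribution hB t_gt0 n)
  (wiener_noise_indep hB t_gt0 n) (euler_coef T t a1 n) (euler_coef T t a2 n)
  (lt0r_neq0 sigma_gt0) (wiener_noise_shift hB t_gt0 n) n.+1 mF F0.
have FE a w : F (stop n.+1 (euler (euler_coef T t a n) sigma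
    (grid_noise t (B ^~ w) n))) = (f (euler_path B T a sigma n w))%:E.
  congr (f _)%:E; apply/funext => s.
  by rewrite /stop idx_le.
move=> E; rewrite -(eq_integral _ _ (fun w _ => FE a2 w)) -E.
by apply: eq_integral => w _; rewrite -(FE a1 w).
Qed.

Let small_density (j : nat) : set Omega :=
  [set w | exists2 n, (j <= n)%N & density n w < j.+1%:R^-1].

Let measurable_small_density j : measurable (small_density j).
Proof.
rewrite (_ : small_density j = \bigcup_(n in [set n | (j <= n)%N])
    (density n @^-1` `]-oo, (j.+1%:R^-1)[%classic)).
  apply: bigcup_measurable => n _; rewrite -[_ @^-1` _]setTI.
  exact: measurable_density.
apply/seteqP; split => w /=.
  by case=> n jn dn; exists n => //=; rewrite in_itv.
by case=> n /= jn; rewrite in_itv/= => dn; exists n.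
Qed.

(** These events decrease with j, and no path along which the densities are eventually
    bounded away from 0 belongs to all of them. *)
Lemma small_density_prob (e : R) : 0 < e ->
  exists j : nat, (P (small_density j) <= e%:E)%E.
Proof.
move=> e0; pose E := small_density; have mE := measurable_small_density.
have dE : {homo E : a b / (a <= b)%N >-> (b <= a)%O}.
  move=> a b ab; apply/subsetPset => w [n bn dn]; exists n.
    exact: leq_trans bn.
  by rewrite (lt_le_trans dn)// lef_pV2 ?posrE// ler_nat.
have PE0 : P (\bigcap_j E j) = 0%E.
  apply/negligibleP; first by apply: bigcapT_measurable.
  have : {ae P, forall w, ~ (\bigcap_j E j) w}.
    apply: filterS2 (solution_pathwise_ae hB tT hX1)
      (wiener_quadratic_variation_ae hB t_gt0).
    move=> w [cX X0 _ sde] Qt Ew.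
    have [k k0 [N _ kN]] :=
      drift_density_eventually_ge a2 t_gt0 tT sigma_gt0 cX X0 sde Qt.
    pose j := maxn N (Num.truncn k^-1).
    have [n /= jn] := Ew j I; rewrite ltNge => /negP; apply.
    apply: le_trans (kN n _); last by rewrite /= (leq_trans (leq_maxl _ _) jn).
    rewrite -[leRHS]invrK lef_pV2 ?posrE ?invr_gt0//.
    rewrite ltW// (lt_le_trans (truncnS_gt _))// ler_nat ltnS.
    exact: leq_maxr.
  by apply: negligibleS => w Ew /=; apply.
have PEcvg : (P \o E) @ \oo --> 0%E.
  rewrite -PE0; apply: nonincreasing_cvg_mu => //.
  - by rewrite (le_lt_trans (probability_le1 _ _)) ?ltry.
  - exact: bigcapT_measurable.
move: PEcvg => /fine_cvgP[_ /cvgrPdist_le/(_ e e0)[j _ /(_ j (leqnn j))]].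
rewrite sub0r normrN ger0_norm ?fine_ge0//= => PEj; exists j.
by rewrite -/(E j) -[leLHS]fineK ?fin_num_measure// lee_fin.
Qed.

(** Outside the event of [small_density_prob] the discrete density is at least
    1 / (j + 1), so E[f(Y1)] <= e + (j + 1) E[Z_n f(Y1)] = e + (j + 1) E[f(Y2)] for the
    Euler schemes; then let n tend to infinity. *)
Lemma test_domination (e : R) : 0 < e -> exists2 K : R, 0 <= K &
  forall f : (set_type `[0, t] -> R) -> R, test_functional f ->
  (\int[P]_w (f (fun s => X1 (set_val s) w))%:E <=
   e%:E + K%:E * \int[P]_w (f (fun s => X2 (set_val s) w))%:E)%E.
Proof.
move=> e0; have [j PE] := small_density_prob e0.
set E := small_density j in PE.
have mE : measurable E by exact: measurable_small_density.
exists j.+1%:R => // f tf.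
have f01 := test_functional_itv01 tf.
have c1 := test_expectation_cvg hB t_gt0 tT hX1 tf.
have c2 := test_expectation_cvg hB t_gt0 tT hX2 tf.
have c3 : (fun n => e%:E + j.+1%:R%:E *
    \int[P]_w (f (euler_path B T a2 sigma n w))%:E)%E @ \oo -->
    (e%:E + j.+1%:R%:E * \int[P]_w (f (fun s => X2 (set_val s) w))%:E)%E.
  apply: cvgeD; first by rewrite fin_num_adde_defr.
    exact: cvg_cst.
  exact: cvgeZl.
rewrite -(cvg_lim _ c1)// -(cvg_lim _ c3)//; apply: lee_lim.
- by apply/cvg_ex; eexists; exact: c1.
- by apply/cvg_ex; eexists; exact: c3.
exists j => // n /= jn.
have mf a : measurable_fun setT (fun w => (f (euler_path B T a sigma n w))%:E).
  apply/measurable_EFinP.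
  exact: (measurable_test_functional (measurable_euler_path B T a sigma n) tf).
have f0 a w : (0 <= (f (euler_path B T a sigma n w))%:E)%E.
  by rewrite lee_fin; have /andP[] := f01 (euler_path B T a sigma n w).
have md : measurable_fun setT (fun w => (density n w)%:E).
  exact/measurable_EFinP/measurable_density.
have d0 w : (0 <= (density n w)%:E)%E by rewrite lee_fin drift_density_ge0.
rewrite -(euler_path_change_of_drift n tf) -ge0_integralZl_EFin//; last 2 first.
- by move=> w _; exact: mule_ge0.
- exact: emeasurable_funM.
apply: le_trans (leeD2r _ PE).
rewrite -[E in P E]setIT -integral_indic// -ge0_integralD//; last 3 first.
- exact/measurable_EFinP/measurable_indic.
- by move=> w _; rewrite !mule_ge0// lee_fin.
- by apply: emeasurable_funM => //; exact: emeasurable_funM.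
apply: ge0_le_integral => //.
- apply: emeasurable_funD; first exact/measurable_EFinP/measurable_indic.
  by apply: emeasurable_funM => //; exact: emeasurable_funM.
move=> w _; rewrite -!EFinM -EFinD lee_fin.
have /andP[g0 g1] := f01 (euler_path B T a1 sigma n w).
rewrite indicE; have [/set_mem wE|wE] := boolP (w \in E).
  rewrite (le_trans g1)// lerDl !mulr_ge0//; exact: drift_density_ge0.
rewrite add0r mulrA ler_peMl// -ler_pdivrMl// mulr1 leNgt; apply/negP => dn.
by move/negP: wE; apply; rewrite inE; exists n.
Qed.

End test_domination.

(** * The dichotomy *)

Section solution_laws.
Context d (Omega : measurableType d) (R : realType) (P : probability Omega R).
Variables (B : R -> {RV P >-> R}) (T t : R).
Hypothesis hB : wiener_process B.
Hypothesis t_gt0 : 0 < t.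
Hypothesis tT : t < T.

Lemma measurable_path_map a sigma (X : R -> {RV P >-> R})
    (hX : strong_solution B T a sigma X) :
  measurable_fun setT (Defs.path_map tT (solution_continuous hX)).
Proof.
apply: (measurable_to_path t_gt0) => s.
exact: measurable_funPT (X (set_val s)).
Qed.

(** Test functionals restricted to C[0, t] generate its Borel sets, so
    [test_domination] can be fed to [null_of_test_domination]. *)
Lemma path_law_dominates a1 a2 sigma (X1 X2 : R -> {RV P >-> R})
    (hX1 : strong_solution B T a1 sigma X1)
    (hX2 : strong_solution B T a2 sigma X2) : 0 < sigma ->
  path_law tT (solution_continuous hX1) `<< path_law tT (solution_continuous hX2).
Proof.
move=> s0.
pose Phi1 : {mfun Omega >-> borel_path_space t} :=
  HB.pack (Defs.path_map tT (solution_continuous hX1))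
    (isMeasurableFun.Build _ _ _ _ _ (measurable_path_map hX1)).
pose Phi2 : {mfun Omega >-> borel_path_space t} :=
  HB.pack (Defs.path_map tT (solution_continuous hX2))
    (isMeasurableFun.Build _ _ _ _ _ (measurable_path_map hX2)).
suff dom : distribution P Phi1 `<< distribution P Phi2 by exact: dom.
apply/null_content_dominatesP => A mA.
pose F := [set f : borel_path_space t -> R |
  exists2 g : (set_type `[0, t] -> R) -> R, test_functional g &
    f = (fun x : path_space t => g x)].
have mF (f : borel_path_space t -> R) : F f -> measurable_fun setT f.
  move=> [g tg ->].
  apply: (measurable_test_functional _ tg) => s; exact: measurable_path_eval.
pose mu1 : {finite_measure set (borel_path_space t) -> \bar R} := distribution P Phi1.
pose mu2 : {finite_measure set (borel_path_space t) -> \bar R} := distribution P Phi2.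
change (mu2 A = 0%E -> mu1 A = 0%E).
apply: (@null_of_test_domination _ (borel_path_space t) R F mF _ _ _ _
  mu1 mu2 (@path_cylinders R t) _ _ A _).
- by move=> f [g tg ->] x; exact: test_functional_itv01.
- by exists (cst 1) => //; exact: test_one.
- by move=> f [g tg ->]; exists (fun y => 1 - g y) => //; exact: test_compl.
- move=> f g [f' tf ->] [g' tg ->]; exists (fun y => f' y * g' y) => //.
  exact: test_mul.
- move=> _ [s [a [b ->]]].
  have [f_ tf_ f_cvg] := @test_coord_itv R (set_type `[0, t]) a b s.
  exists (fun n (x : path_space t) => f_ n x).
    by move=> n; exists (f_ n).
  by move=> x; have := f_cvg x.
- move=> e /(test_domination hB t_gt0 tT s0 hX1 hX2)[K K0 dom].
  exists K => // f Ff.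
  have [mf [g tg fE]] := (mF f Ff, Ff).
  have f0 x : (0 <= (f x)%:E)%E.
    by rewrite fE lee_fin; have /andP[] := test_functional_itv01 tg x.
  rewrite !ge0_integral_distribution//; last 2 first.
  - exact/measurable_EFinP.
  - exact/measurable_EFinP.
  by rewrite fE; exact: dom.
- exact: measurable_borel_path.
Qed.

Definition path_quadratic_variation (n : nat) (x : borel_path_space t) : R :=
  \sum_(i < n.+1) (x (clamp t_gt0 (i.+1%:R * (t / n.+1%:R))) -
                   x (clamp t_gt0 (i%:R * (t / n.+1%:R)))) ^+ 2.

Lemma measurable_path_quadratic_variation n :
  measurable_fun setT (path_quadratic_variation n).
Proof.
apply: measurable_sum => i; apply: measurable_funX.
by apply: measurable_funB; exact: measurable_path_eval.
Qed.

Lemma path_quadratic_variation_ae a sigma (X : R -> {RV P >-> R})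
    (hX : strong_solution B T a sigma X) :
  {ae P, forall w, path_quadratic_variation n
    (Defs.path_map tT (solution_continuous hX) w) @[n --> \oo] --> sigma ^+ 2 * t}.
Proof.
apply: filterS2 (solution_pathwise_ae hB tT hX)
  (wiener_quadratic_variation_ae hB t_gt0).
move=> w [cX X0 cB sde] Qt.
have pathE r : 0 <= r <= t ->
    Defs.path_map tT (solution_continuous hX) w (clamp t_gt0 r) = X r w.
  by move=> rt; rewrite -[in RHS](clampE t_gt0 rt).
under eq_cvg => n.
  rewrite /path_quadratic_variation.
  under eq_bigr => i _.
    rewrite pathE; last exact: grid_in.
    rewrite pathE; last by apply: grid_in => //; exact: ltnW.
    over.
  over.
exact: (quadratic_variation_cvg t_gt0 tT cX cB sde Qt).
Qed.

Definition near_variation (v eta : R) : set (borel_path_space t) :=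
  \bigcup_N \bigcap_(n in [set n | (N <= n)%N])
    [set x | `|path_quadratic_variation n x - v| < eta].

Lemma measurable_near_variation v eta : measurable (near_variation v eta).
Proof.
apply: bigcupT_measurable => N; apply: bigcap_measurableType => n _.
rewrite (_ : [set _ | _] =
  path_quadratic_variation n @^-1` `](v - eta), (v + eta)[%classic).
  rewrite -[_ @^-1` _]setTI; exact: measurable_path_quadratic_variation.
by apply/seteqP; split => x /=; rewrite in_itv/= ltr_distl.
Qed.

Lemma path_law_near_variation a sigma (X : R -> {RV P >-> R})
    (hX : strong_solution B T a sigma X) v eta : 0 < eta ->
  (sigma ^+ 2 * t = v ->
     path_law tT (solution_continuous hX) (~` near_variation v eta) = 0%E) /\
  (2 * eta <= `|v - sigma ^+ 2 * t| ->
     path_law tT (solution_continuous hX) (near_variation v eta) = 0%E).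
Proof.
move=> eta0; have mV := measurable_near_variation v eta.
have null (A : set (borel_path_space t)) : measurable A ->
    {ae P, forall w, ~ A (Defs.path_map tT (solution_continuous hX) w)} ->
    path_law tT (solution_continuous hX) A = 0%E.
  move=> mA nA.
  have mpA := measurable_path_map hX measurableT mA; rewrite setTI in mpA.
  apply/(negligibleP P mpA).
  by apply: negligibleS nA => w Aw /=; apply.
split=> [sv|etav]; apply: null => //; first exact: measurableC.
- apply: filterS (path_quadratic_variation_ae hX) => w /cvgrPdist_lt/(_ eta eta0).
  case=> N _ NP; apply; exists N => // n /= Nn; rewrite -sv distrC.
  exact: NP.
- apply: filterS (path_quadratic_variation_ae hX) => w /cvgrPdist_lt/(_ eta eta0).
  case=> N _ NP [N' _ N'P].
  have := N'P (maxn N N') (leq_maxr _ _); have := NP (maxn N N') (leq_maxl _ _).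
  rewrite /=; set q := path_quadratic_variation _ _ => q1 q2.
  move: etav; rewrite leNgt => /negP; apply.
  rewrite (le_lt_trans (ler_distD q _ _))// mulr_natl mulr2n.
  by rewrite ltrD// distrC.
Qed.

(** The separating event is that the quadratic variation is eventually closer to
    sigma2^2 t than half the distance between the two limits. *)
Lemma path_law_singular a1 a2 sigma1 sigma2 (X1 X2 : R -> {RV P >-> R})
    (hX1 : strong_solution B T a1 sigma1 X1)
    (hX2 : strong_solution B T a2 sigma2 X2) :
  0 < sigma1 -> 0 < sigma2 -> sigma1 <> sigma2 ->
  mutually_singular (path_law tT (solution_continuous hX1))
                    (path_law tT (solution_continuous hX2)).
Proof.
move=> s1 s2 s12.
pose v := sigma2 ^+ 2 * t; pose eta := `|v - sigma1 ^+ 2 * t| / 2.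
have eta0 : 0 < eta.
  rewrite divr_gt0// normr_gt0 subr_eq0; apply/eqP => /(mulIf (lt0r_neq0 t_gt0)).
  by move/eqP; rewrite eqrXn2 ?ltW// => /eqP/esym.
exists (near_variation v eta); first exact: measurable_near_variation.
split; last exact: (path_law_near_variation hX2 v eta0).1.
apply: (path_law_near_variation hX1 v eta0).2.
by rewrite /eta mulrC divfK.
Qed.

End solution_laws.

Unset Implicit Arguments.
Set Strict Implicit.

Theorem theorem4p5 (R : realType) (d : measure_display)
    (Omega : measurableType d) (P : probability Omega R)
    (B : R -> {RV P >-> R}) (hB : wiener_process B)
    (T : R) (T_gt0 : 0 < T)
    (alpha1 alpha2 sigma1 sigma2 : R)
    (sigma1_gt0 : 0 < sigma1) (sigma2_gt0 : 0 < sigma2)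
    (X1 X2 : R -> {RV P >-> R})
    (hX1 : strong_solution B T alpha1 sigma1 X1)
    (hX2 : strong_solution B T alpha2 sigma2 X2)
    (t : R) (t_gt0 : 0 < t) (tT : t < T) :
  let law1 := path_law tT (solution_continuous hX1) in
  let law2 := path_law tT (solution_continuous hX2) in
  (sigma1 = sigma2 -> equivalent_measures law1 law2) /\
  (sigma1 <> sigma2 -> mutually_singular law1 law2).
Proof.
move=> law1 law2; split=> [s12|s12].
- rewrite /law1 /law2; clear law1 law2; subst sigma2.
  by split; apply: (path_law_dominates hB t_gt0).
- exact: (path_law_singular hB t_gt0).
Qed.
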